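(* Let $\Theta\subset\Pi$ and let $\varphi:W_\Theta\backslash W\to\mathcal H_\Theta$ be a function satisfying $$\varphi(C)=\delta_C+\sum_{D<C}P_{CD}\,\delta_D\quad\text{with }P_{CD}\in q\mathbb Z[q]$$ for all $C\in W_\Theta\backslash W$. Then the following are equivalent. (i) If $\alpha\in\Pi$ and $C\in W_\Theta\backslash W$ are such that $Cs_\alpha<C$, then there exist $m_D\in\mathbb Z$ such that $$T_\alpha(\varphi(Cs_\alpha))=\sum_{D\le C}m_D\,\varphi(D).$$ (ii) All $\varphi(C)$, $C\in W_\Theta\backslash W$, are self-dual.
   Context: Let $W$ be the Weyl group of a reduced root system with simple roots $\Pi$ and simple reflections $S=\{s_\alpha\}_{\alpha\in\Pi}$, length $\ell$; $\Theta\subset\Pi$, $W_\Theta\subset W$ the subgroup generated by $s_\alpha$, $\alpha\in\Theta$. For a coset $C\in W_\Theta\backslash W$, $w^C$ is its unique longest element; $C\le D$ means $w^C\le w^D$ in the Bruhat order. $\mathcal H_\Theta$ is the free $\mathbb Z[q,q^{-1}]$-module with basis $\{\delta_C\}_{C\in W_\Theta\backslash W}$, and for $\alpha\in\Pi$, $T_\alpha$ is its $\mathbb Z[q,q^{-1}]$-linear endomorphism with $T_\alpha(\delta_C)=0$ if $Cs_\alpha=C$; $q\delta_C+\delta_{Cs_\alpha}$ if $Cs_\alpha>C$; $q^{-1}\delta_C+\delta_{Cs_\alpha}$ if $Cs_\alpha<C$. The Hecke algebra $\mathcal H$ of $(W,S)$ is the associative $\mathbb Z[q,q^{-1}]$-algebra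 with generators $H_s$, $s\in S$, satisfying the braid relations and $(H_s+q)(H_s-q^{-1})=0$; $H_w=H_{s_1}\cdots H_{s_k}$ for a reduced expression $w=s_1\cdots s_k$. There is a unique ring homomorphism $H\mapsto\overline H$ of $\mathcal H$ with $\overline q=q^{-1}$ and $\overline{H_w}=(H_{w^{-1}})^{-1}$. Let $\mathcal H^\Theta\subset\mathcal H$ be the subalgebra generated by $H_{s_\alpha}$, $\alpha\in\Theta$. The map $H_{s_\alpha}\mapsto-q$ ($\alpha\in\Theta$) makes $\mathbb Z[q,q^{-1}]$ an $\mathcal H^\Theta$-bimodule, and the antispherical module is the right $\mathcal H$-module $\mathcal N^\Theta=\mathbb Z[q,q^{-1}]\otimes_{\mathcal H^\Theta}\mathcal H$, with $\mathbb Z[q,q^{-1}]$-basis $N_w=1\otimes H_w$, $w$ running over shortest elements of the cosets in $W_\Theta\backslash W$. It carries the additive involution $\overline{a\otimes H}=\overline a\otimes\overline H$. With $w_\Theta$ the longest element of $W_\Theta$ (so $w_\Theta w^C$ is the shortest element of $C$), let $\phi:\mathcal H_\Theta\to\mathcal N^\Theta$ be the $\mathbb Z[q,q^{-1}]$-module isomorphism $\delta_C\mapsto N_{w_\Theta w^C}$. An element $E\in\mathcal H_\Theta$ is self-dual if $\overline{\phi(E)}=\phi(E)$. *)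

(* Defs.v *)
From HB Require Import structures.
From mathcomp Require Import all_boot all_order all_algebra all_fingroup.
From mathcomp Require Import generic_quotient boolp.

Set Implicit Arguments.
Unset Strict Implicit.
Unset Printing Implicit Defensive.

Import Order.TTheory GRing.Theory Num.Theory.
Local Open Scope ring_scope.
Local Open Scope quotient_scope.

(* -------------------------------------------------------------------------- *)
(* Z[q, q^-1], as the subring of Frac Z[q] of the fractions p / q^n.          *)
(* -------------------------------------------------------------------------- *)

Definition laurent_pred : {pred {fraction {poly int}}} :=
  fun x => `[< exists np : nat * {poly int}, x * (tofrac 'X) ^+ np.1 = tofrac np.2 >].

Fact laurent_subring_closed : subring_closed laurent_pred.
Proof.
split.
- by apply/asboolP; exists (0%N, 1); rewrite /= expr0 mulr1 tofrac1.
- move=> x y /asboolP[[n p] /= hx] /asboolP[[k r] /= hy]; apply/asboolP.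
  exists ((n + k)%N, p * 'X^k - r * 'X^n) => /=.
  rewrite tofracB !tofracM !tofracXn -hx -hy mulrBl exprD; congr (_ - _).
    by rewrite mulrA.
  by rewrite [_ ^+ n * _]mulrC mulrA.
- move=> x y /asboolP[[n p] /= hx] /asboolP[[k r] /= hy]; apply/asboolP.
  by exists ((n + k)%N, p * r) => /=; rewrite tofracM -hx -hy exprD mulrACA.
Qed.

HB.instance Definition _ :=
  GRing.isSubringClosed.Build {fraction {poly int}} laurent_pred
    laurent_subring_closed.

Record laurent := Laurent {
  laurent_val :> {fraction {poly int}};
  laurent_valP : laurent_val \in laurent_pred }.

HB.instance Definition _ := [isSub for laurent_val].
HB.instance Definition _ := [Choice of laurent by <:].
HB.instance Definition _ := [SubChoice_isSubComNzRing of laurent by <:].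

Fact laurent_poly_subproof (p : {poly int}) : tofrac p \in laurent_pred.
Proof. by apply/asboolP; exists (0%N, p); rewrite /= expr0 mulr1. Qed.

Definition laurent_poly (p : {poly int}) : laurent :=
  Laurent (laurent_poly_subproof p).

Fact laurent_poly_is_zmod_morphism : zmod_morphism laurent_poly.
Proof. by move=> p r; apply: val_inj; rewrite /= tofracB. Qed.

Fact laurent_poly_is_monoid_morphism : monoid_morphism laurent_poly.
Proof.
by split=> [|p r]; apply: val_inj; rewrite /= ?tofrac1 ?tofracM.
Qed.

HB.instance Definition _ := GRing.isZmodMorphism.Build {poly int} laurent
  laurent_poly laurent_poly_is_zmod_morphism.
HB.instance Definition _ := GRing.isMonoidMorphism.Build {poly int} laurent
  laurent_poly laurent_poly_is_monoid_morphism.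

Lemma laurent_poly_inj : injective laurent_poly.
Proof. by move=> p r [/eqP]; rewrite tofrac_eq => /eqP. Qed.

Definition lq : laurent := laurent_poly 'X.

Fact tofracX_neq0 : tofrac ('X : {poly int}) != 0.
Proof. by rewrite tofrac_eq0 polyX_eq0. Qed.

Fact lqV_subproof : (tofrac 'X)^-1 \in laurent_pred.
Proof. by apply/asboolP; exists (1%N, 1); rewrite /= tofrac1 mulVf ?tofracX_neq0. Qed.

Definition lqV : laurent := Laurent lqV_subproof.

Lemma lqVq : lqV * lq = 1.
Proof. by apply: val_inj; rewrite /= mulVf ?tofracX_neq0. Qed.

Lemma lqqV : lq * lqV = 1.
Proof. by rewrite mulrC lqVq. Qed.

Lemma laurentP (x : laurent) :
  exists np : nat * {poly int}, x * lq ^+ np.1 = laurent_poly np.2.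
Proof.
case: x => x hx; case/asboolP: (hx) => [[n p] /= h].
by exists (n, p); apply: val_inj; rewrite rmorphM rmorphXn.
Qed.

(* The ring involution of Z[q, q^-1] exchanging q and q^-1: p(q) / q^n is     *)
(* sent to p(q^-1) q^n (see lbarE for the independence of p and n).           *)
Definition eval_lqV (p : {poly int}) : laurent := (map_poly intr p).[lqV].

Definition lbar (x : laurent) : laurent :=
  let np := projT1 (cid (laurentP x)) in eval_lqV np.2 * lq ^+ np.1.

Fact eval_lqVD p r : eval_lqV (p - r) = eval_lqV p - eval_lqV r.
Proof. by rewrite /eval_lqV rmorphB hornerD hornerN. Qed.

Fact eval_lqVM p r : eval_lqV (p * r) = eval_lqV p * eval_lqV r.
Proof. by rewrite /eval_lqV rmorphM hornerM. Qed.

Fact eval_lqVXn n : eval_lqV 'X^n = lqV ^+ n.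
Proof. by rewrite /eval_lqV map_polyXn hornerXn. Qed.

Lemma lbarE x n p : x * lq ^+ n = laurent_poly p -> lbar x = eval_lqV p * lq ^+ n.
Proof.
rewrite /lbar; case: (cid _) => [[k r] /= hr] hp.
have e : r * 'X^n = p * 'X^k.
  by apply: laurent_poly_inj; rewrite !rmorphM !rmorphXn /= -/lq -hr -hp mulrAC.
have := congr1 eval_lqV e; rewrite !eval_lqVM !eval_lqVXn.
move=> /(congr1 (fun y => y * (lq ^+ n * lq ^+ k))).
have K j : lqV ^+ j * lq ^+ j = 1 by rewrite -exprMn lqVq expr1n.
rewrite mulrA -(mulrA _ _ (lq ^+ n)) K mulr1 => ->.
by rewrite [lq ^+ n * _]mulrC mulrA -(mulrA _ _ (lq ^+ k)) K mulr1.
Qed.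

Fact lbar_is_zmod_morphism : zmod_morphism lbar.
Proof.
move=> x y; case: (laurentP x) => [[n p] /= hx]; case: (laurentP y) => [[k r] /= hy].
have h : (x - y) * lq ^+ (n + k) = laurent_poly (p * 'X^k - r * 'X^n).
  rewrite rmorphB !rmorphM !rmorphXn /= -/lq -hx -hy mulrBl exprD; congr (_ - _).
    by rewrite mulrA.
  by rewrite [_ ^+ n * _]mulrC mulrA.
have K j : lqV ^+ j * lq ^+ j = 1 by rewrite -exprMn lqVq expr1n.
rewrite (lbarE hx) (lbarE hy) (lbarE h) eval_lqVD !eval_lqVM !eval_lqVXn exprD.
rewrite mulrBl; congr (_ - _).
  by rewrite [lq ^+ n * _]mulrC mulrA -(mulrA _ _ (lq ^+ k)) K mulr1.
by rewrite mulrA -(mulrA _ _ (lq ^+ n)) K mulr1.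
Qed.

Fact lbar_is_monoid_morphism : monoid_morphism lbar.
Proof.
split=> [|x y].
  have h : (1 : laurent) * lq ^+ 0 = laurent_poly 1 by rewrite expr0 mulr1 rmorph1.
  by rewrite (lbarE h) /eval_lqV rmorph1 hornerC mulr1.
case: (laurentP x) => [[n p] /= hx]; case: (laurentP y) => [[k r] /= hy].
have h : (x * y) * lq ^+ (n + k) = laurent_poly (p * r).
  by rewrite rmorphM /= -hx -hy exprD mulrACA.
by rewrite (lbarE hx) (lbarE hy) (lbarE h) eval_lqVM exprD mulrACA.
Qed.

HB.instance Definition _ := GRing.isZmodMorphism.Build laurent laurent
  lbar lbar_is_zmod_morphism.
HB.instance Definition _ := GRing.isMonoidMorphism.Build laurent laurent
  lbar lbar_is_monoid_morphism.

Lemma lbarq : lbar lq = lqV.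
Proof.
have h : lq * lq ^+ 0 = laurent_poly 'X by rewrite expr0 mulr1.
by rewrite (lbarE h) /eval_lqV map_polyX hornerX expr0 mulr1.
Qed.

Lemma lbarqV : lbar lqV = lq.
Proof.
have h : lqV * lq ^+ 1 = laurent_poly 1 by rewrite expr1 lqVq rmorph1.
by rewrite (lbarE h) /eval_lqV rmorph1 hornerC expr1 mul1r.
Qed.

Definition in_qZq (x : laurent) : Prop :=
  exists p : {poly int}, x = lq * laurent_poly p.

(* -------------------------------------------------------------------------- *)
(* The Hecke algebra of a Coxeter matrix m : I -> I -> nat, as the algebra of *)
(* noncommutative polynomial expressions in the H_s modulo the congruence     *)
(* generated by the algebra axioms, the quadratic and the braid relations.    *)
(* -------------------------------------------------------------------------- *)

Section Hecke.
Variables (I : Type) (m : I -> I -> nat).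

Inductive hterm : Type :=
  | HGen of I
  | HScal of laurent
  | HAdd of hterm & hterm
  | HMul of hterm & hterm.

Definition hword (w : seq I) : hterm :=
  foldr HMul (HScal 1) [seq HGen s | s <- w].

(* s, t, s, t, ... (n letters) *)
Definition altword (n : nat) (s t : I) : seq I :=
  [seq if odd k then t else s | k <- iota 0 n].

Inductive hrel : hterm -> hterm -> Prop :=
  | hrel_refl x : hrel x x
  | hrel_sym x y : hrel x y -> hrel y x
  | hrel_trans x y z : hrel x y -> hrel y z -> hrel x z
  | hrel_add x x' y y' : hrel x x' -> hrel y y' -> hrel (HAdd x y) (HAdd x' y')
  | hrel_mul x x' y y' : hrel x x' -> hrel y y' -> hrel (HMul x y) (HMul x' y')
  | hrel_addA x y z : hrel (HAdd x (HAdd y z)) (HAdd (HAdd x y) z)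
  | hrel_addC x y : hrel (HAdd x y) (HAdd y x)
  | hrel_add0 x : hrel (HAdd (HScal 0) x) x
  | hrel_mulA x y z : hrel (HMul x (HMul y z)) (HMul (HMul x y) z)
  | hrel_mul1 x : hrel (HMul (HScal 1) x) x
  | hrel_mul0 x : hrel (HMul (HScal 0) x) (HScal 0)
  | hrel_mulDl x y z : hrel (HMul (HAdd x y) z) (HAdd (HMul x z) (HMul y z))
  | hrel_mulDr x y z : hrel (HMul x (HAdd y z)) (HAdd (HMul x y) (HMul x z))
  | hrel_scalD a b : hrel (HScal (a + b)) (HAdd (HScal a) (HScal b))
  | hrel_scalM a b : hrel (HScal (a * b)) (HMul (HScal a) (HScal b))
  | hrel_scalC a x : hrel (HMul (HScal a) x) (HMul x (HScal a))
  | hrel_quadratic s :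
      hrel (HMul (HAdd (HGen s) (HScal lq)) (HAdd (HGen s) (HScal (- lqV))))
           (HScal 0)
  | hrel_braid s t :
      hrel (hword (altword (m s t) s t)) (hword (altword (m s t) t s)).

HB.instance Definition _ := gen_eqMixin hterm.
HB.instance Definition _ := gen_choiceMixin hterm.

Definition hequiv (x y : hterm) : bool := `[< hrel x y >].

Fact hequiv_refl : reflexive hequiv.
Proof. by move=> x; apply/asboolP; apply: hrel_refl. Qed.

Fact hequiv_sym : symmetric hequiv.
Proof. by move=> x y; apply/asboolP/asboolP; apply: hrel_sym. Qed.

Fact hequiv_trans : transitive hequiv.
Proof.
by move=> y x z /asboolP h1 /asboolP h2; apply/asboolP; apply: hrel_trans h1 h2.
Qed.

Canonical hequiv_equiv := EquivRel hequiv hequiv_refl hequiv_sym hequiv_trans.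

Definition hecke := {eq_quot hequiv}.

HB.instance Definition _ : EqQuotient hterm hequiv hecke := EqQuotient.on hecke.
HB.instance Definition _ := Choice.on hecke.

Definition hclass (x : hterm) : hecke := \pi_hecke x.

Lemma hclassP x y : hclass x = hclass y <-> hrel x y.
Proof.
split=> [/eqmodP/asboolP //|h]; apply/eqmodP; exact/asboolP.
Qed.

Lemma hclass_repr (x : hecke) : hclass (repr x) = x.
Proof. exact: reprK. Qed.

Lemma hclass_reprP x : hrel (repr (hclass x)) x.
Proof. by apply/hclassP; rewrite hclass_repr. Qed.

Lemma heckeW (P : hecke -> Prop) : (forall x, P (hclass x)) -> forall x, P x.
Proof. by move=> h x; rewrite -(hclass_repr x). Qed.

Definition hecke_add (x y : hecke) : hecke := hclass (HAdd (repr x) (repr y)).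
Definition hecke_mul (x y : hecke) : hecke := hclass (HMul (repr x) (repr y)).
Definition hecke_scal (a : laurent) : hecke := hclass (HScal a).
Definition hecke_opp (x : hecke) : hecke := hecke_mul (hecke_scal (- 1)) x.
Definition hecke_scale (a : laurent) (x : hecke) : hecke :=
  hecke_mul (hecke_scal a) x.
Definition hecke_gen (s : I) : hecke := hclass (HGen s).

Lemma hclassD x y : hclass (HAdd x y) = hecke_add (hclass x) (hclass y).
Proof. by apply/hclassP/hrel_sym/hrel_add; apply: hclass_reprP. Qed.

Lemma hclassM x y : hclass (HMul x y) = hecke_mul (hclass x) (hclass y).
Proof. by apply/hclassP/hrel_sym/hrel_mul; apply: hclass_reprP. Qed.

Fact hecke_addA : associative hecke_add.
Proof.
elim/heckeW=> x; elim/heckeW=> y; elim/heckeW=> z; rewrite -!hclassD.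
exact/hclassP/hrel_addA.
Qed.

Fact hecke_addC : commutative hecke_add.
Proof.
by elim/heckeW=> x; elim/heckeW=> y; rewrite -!hclassD; exact/hclassP/hrel_addC.
Qed.

Fact hecke_add0 : left_id (hecke_scal 0) hecke_add.
Proof. by elim/heckeW=> x; rewrite -!hclassD; exact/hclassP/hrel_add0. Qed.

Fact hecke_mulA : associative hecke_mul.
Proof.
elim/heckeW=> x; elim/heckeW=> y; elim/heckeW=> z; rewrite -!hclassM.
exact/hclassP/hrel_mulA.
Qed.

Fact hecke_mul1 : left_id (hecke_scal 1) hecke_mul.
Proof. by elim/heckeW=> x; rewrite -!hclassM; exact/hclassP/hrel_mul1. Qed.

Fact hecke_scalC a x : hecke_mul (hecke_scal a) x = hecke_mul x (hecke_scal a).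
Proof. by elim/heckeW: x=> x; rewrite -!hclassM; exact/hclassP/hrel_scalC. Qed.

Fact hecke_mulr1 : right_id (hecke_scal 1) hecke_mul.
Proof. by move=> x; rewrite -hecke_scalC hecke_mul1. Qed.

Fact hecke_mul0 x : hecke_mul (hecke_scal 0) x = hecke_scal 0.
Proof. by elim/heckeW: x=> x; rewrite -!hclassM; exact/hclassP/hrel_mul0. Qed.

Fact hecke_mulDl : left_distributive hecke_mul hecke_add.
Proof.
elim/heckeW=> x; elim/heckeW=> y; elim/heckeW=> z.
by rewrite -!(hclassM, hclassD); exact/hclassP/hrel_mulDl.
Qed.

Fact hecke_mulDr : right_distributive hecke_mul hecke_add.
Proof.
elim/heckeW=> x; elim/heckeW=> y; elim/heckeW=> z.
by rewrite -!(hclassM, hclassD); exact/hclassP/hrel_mulDr.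
Qed.

Fact hecke_scalD a b :
  hecke_scal (a + b) = hecke_add (hecke_scal a) (hecke_scal b).
Proof. by rewrite -hclassD; exact/hclassP/hrel_scalD. Qed.

Fact hecke_scalM a b :
  hecke_scal (a * b) = hecke_mul (hecke_scal a) (hecke_scal b).
Proof. by rewrite -hclassM; exact/hclassP/hrel_scalM. Qed.

Fact hecke_addN : left_inverse (hecke_scal 0) hecke_opp hecke_add.
Proof.
move=> x; rewrite /hecke_opp -[X in hecke_add _ X]hecke_mul1 -hecke_mulDl.
by rewrite -hecke_scalD addNr hecke_mul0.
Qed.

(* The sign character H_s |-> -q. *)
Fixpoint hterm_sgn (x : hterm) : laurent :=
  match x with
  | HGen _ => - lq
  | HScal a => a
  | HAdd x y => hterm_sgn x + hterm_sgn y
  | HMul x y => hterm_sgn x * hterm_sgn y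
  end.

Lemma hterm_sgn_hword w : hterm_sgn (hword w) = (- lq) ^+ size w.
Proof. by elim: w => [|s w /= ->]; rewrite ?expr0 // exprS. Qed.

Lemma size_altword n s t : size (altword n s t) = n.
Proof. by rewrite size_map size_iota. Qed.

Lemma hterm_sgn_rel x y : hrel x y -> hterm_sgn x = hterm_sgn y.
Proof.
elim=> //= {x y}.
- by move=> x y z _ -> _ ->.
- by move=> x x' y y' _ -> _ ->.
- by move=> x x' y y' _ -> _ ->.
- by move=> x y z; rewrite addrA.
- by move=> x y; rewrite addrC.
- by move=> x; rewrite add0r.
- by move=> x y z; rewrite mulrA.
- by move=> x; rewrite mul1r.
- by move=> x; rewrite mul0r.
- by move=> x y z; rewrite mulrDl.
- by move=> x y z; rewrite mulrDr.
- by move=> a x; rewrite mulrC.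
- by move=> s; rewrite addNr mul0r.
- by move=> s t; rewrite !hterm_sgn_hword !size_altword.
Qed.

Definition hecke_sgn (x : hecke) : laurent := hterm_sgn (repr x).

Lemma hecke_sgnE x : hecke_sgn (hclass x) = hterm_sgn x.
Proof. exact/hterm_sgn_rel/hclass_reprP. Qed.

Fact hecke_1neq0 : hecke_scal 1 != hecke_scal 0.
Proof.
apply/eqP=> /(congr1 hecke_sgn); rewrite !hecke_sgnE /= => /eqP.
by rewrite oner_eq0.
Qed.

HB.instance Definition _ := GRing.isZmodule.Build hecke
  hecke_addA hecke_addC hecke_add0 hecke_addN.
HB.instance Definition _ := GRing.Zmodule_isNzRing.Build hecke
  hecke_mulA hecke_mul1 hecke_mulr1 hecke_mulDl hecke_mulDr hecke_1neq0.

Fact hecke_scalerA a b x :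
  hecke_scale a (hecke_scale b x) = hecke_scale (a * b) x.
Proof. by rewrite /hecke_scale hecke_mulA -hecke_scalM. Qed.

Fact hecke_scale1 : left_id 1 hecke_scale.
Proof. exact: hecke_mul1. Qed.

Fact hecke_scalerDr : right_distributive hecke_scale +%R.
Proof. by move=> a x y; apply: hecke_mulDr. Qed.

Fact hecke_scalerDl x : {morph hecke_scale^~ x : a b / a + b}.
Proof. by move=> a b; rewrite /hecke_scale hecke_scalD hecke_mulDl. Qed.

HB.instance Definition _ := GRing.Zmodule_isLmodule.Build laurent hecke
  hecke_scalerA hecke_scale1 hecke_scalerDr hecke_scalerDl.

Fact hecke_scalerAl (a : laurent) (x y : hecke) : a *: (x * y) = (a *: x) * y.
Proof. exact: hecke_mulA. Qed.

HB.instance Definition _ := GRing.Lmodule_isLalgebra.Build laurent hecke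
  hecke_scalerAl.

Fact hecke_scalerAr (a : laurent) (x y : hecke) : a *: (x * y) = x * (a *: y).
Proof.
rewrite hecke_scalerAl.
change (hecke_mul (hecke_mul (hecke_scal a) x) y
        = hecke_mul x (hecke_mul (hecke_scal a) y)).
by rewrite hecke_scalC hecke_mulA.
Qed.

HB.instance Definition _ := GRing.Lalgebra_isAlgebra.Build laurent hecke
  hecke_scalerAr.

Lemma hclassDE x y : hclass (HAdd x y) = hclass x + hclass y.
Proof. exact: hclassD. Qed.

Lemma hclassME x y : hclass (HMul x y) = hclass x * hclass y.
Proof. exact: hclassM. Qed.

Lemma hclassS a : hclass (HScal a) = a%:A.
Proof. by rewrite -[LHS]mulr1. Qed.

Definition hecke_word (w : seq I) : hecke := \prod_(s <- w) hecke_gen s.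

Lemma hclass_word w : hclass (hword w) = hecke_word w.
Proof.
rewrite /hecke_word; elim: w => [|s w IH]; first by rewrite big_nil.
by rewrite big_cons -IH -hclassME.
Qed.

Lemma hecke_quadratic s :
  (hecke_gen s + lq%:A) * (hecke_gen s - lqV%:A) = 0.
Proof.
have /hclassP := hrel_quadratic s.
by rewrite hclassME !hclassDE !hclassS scaleNr scale0r.
Qed.

Lemma hecke_braid s t :
  hecke_word (altword (m s t) s t) = hecke_word (altword (m s t) t s).
Proof. by rewrite -!hclass_word; exact/hclassP/hrel_braid. Qed.

(* H_s^-1 = H_s + q - q^-1 *)
Definition hecke_genV (s : I) : hecke := hecke_gen s + (lq - lqV)%:A.

Lemma hecke_genK s : hecke_gen s * hecke_genV s = 1.
Proof.
have := hecke_quadratic s; set h := hecke_gen s; rewrite /hecke_genV -/h.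
rewrite mulrDl !mulrBr !mulr_algr !mulr_algl scalerA lqVq scale1r.
rewrite mulrDr mulr_algr scalerBl => e.
move: e; rewrite addrA => /eqP; rewrite subr_eq0 => /eqP <-.
by rewrite -addrA [- _ + _]addrC.
Qed.

Lemma hecke_genVK s : hecke_genV s * hecke_gen s = 1.
Proof.
rewrite -[RHS](hecke_genK s) /hecke_genV mulrDl mulrDr; congr (_ + _).
by rewrite mulr_algl mulr_algr.
Qed.

Definition hecke_wordV (w : seq I) : hecke := \prod_(s <- w) hecke_genV s.

Lemma hecke_wordVK w : hecke_wordV w * hecke_word (rev w) = 1.
Proof.
rewrite /hecke_wordV /hecke_word.
elim: w => [|s w IH]; first by rewrite !big_nil mulr1.
rewrite rev_cons big_cons -cats1 big_cat big_seq1 /= mulrA -(mulrA (hecke_genV s)).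
by rewrite IH mulr1 hecke_genVK.
Qed.

Lemma hecke_wordKV w : hecke_word (rev w) * hecke_wordV w = 1.
Proof.
rewrite /hecke_wordV /hecke_word.
elim: w => [|s w IH]; first by rewrite !big_nil mulr1.
rewrite rev_cons big_cons -cats1 big_cat big_seq1 /= -mulrA (mulrA (hecke_gen s)).
by rewrite hecke_genK mul1r IH.
Qed.

Arguments altword : simpl never.

Lemma rev_altword n s t :
  rev (altword n s t) = if odd n then altword n s t else altword n t s.
Proof.
have rec k a b : altword k.+1 a b = rcons (altword k a b) (if odd k then b else a).
  by rewrite /altword -[k.+1]addn1 iotaD map_cat /= cats1.
have cons k a b : altword k.+1 a b = a :: altword k b a.
  rewrite /altword /= -[1%N]/(1 + 0)%N iotaDl -map_comp; congr (_ :: _).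
  by apply: eq_map => j /=; case: (odd j).
elim: n => [|n IH] //; rewrite [in rev _]rec rev_rcons IH /=.
by case: (odd n); rewrite /= -cons.
Qed.

Lemma hecke_braidV s t :
  hecke_wordV (altword (m s t) s t) = hecke_wordV (altword (m s t) t s).
Proof.
set u := altword _ s t; set v := altword _ t s.
have e : hecke_word (rev u) = hecke_word (rev v).
  by rewrite !rev_altword; case: ifP => _; rewrite hecke_braid.
by rewrite -[LHS]mulr1 -(hecke_wordKV v) -e mulrA hecke_wordVK mul1r.
Qed.

(* The bar involution is the ring endomorphism with q |-> q^-1 and            *)
(* H_s |-> H_s^-1; see hecke_bar_wordK and hecke_bar_wordKV below, which give *)
(* bar H_w = (H_{w^-1})^-1 for any reduced expression of w, its reversal      *)
(* being a reduced expression of w^-1.                                        *)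
Fixpoint hterm_bar (x : hterm) : hecke :=
  match x with
  | HGen s => hecke_genV s
  | HScal a => (lbar a)%:A
  | HAdd x y => hterm_bar x + hterm_bar y
  | HMul x y => hterm_bar x * hterm_bar y
  end.

Lemma hterm_bar_word w : hterm_bar (hword w) = hecke_wordV w.
Proof.
rewrite /hecke_wordV; elim: w => [|s w IH]; last by rewrite big_cons /= IH.
by rewrite big_nil /= rmorph1 scale1r.
Qed.

Lemma hterm_bar_rel x y : hrel x y -> hterm_bar x = hterm_bar y.
Proof.
elim=> //= {x y}.
- by move=> x y z _ -> _ ->.
- by move=> x x' y y' _ -> _ ->.
- by move=> x x' y y' _ -> _ ->.
- by move=> x y z; rewrite addrA.
- by move=> x y; rewrite addrC.
- by move=> x; rewrite rmorph0 scale0r add0r.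
- by move=> x y z; rewrite mulrA.
- by move=> x; rewrite rmorph1 scale1r mul1r.
- by move=> x; rewrite rmorph0 scale0r mul0r.
- by move=> x y z; rewrite mulrDl.
- by move=> x y z; rewrite mulrDr.
- by move=> a b; rewrite rmorphD scalerDl.
- by move=> a b; rewrite rmorphM -scalerAl mul1r scalerA.
- by move=> a x; rewrite mulr_algl mulr_algr.
- move=> s; rewrite rmorph0 rmorphN /= lbarq lbarqV /hecke_genV scale0r.
  rewrite -!addrA -!scalerDl subrK addrAC subrr add0r scaleNr.
  exact: hecke_quadratic.
- by move=> s t; rewrite !hterm_bar_word hecke_braidV.
Qed.

Definition hecke_bar (x : hecke) : hecke := hterm_bar (repr x).

Lemma hecke_barE x : hecke_bar (hclass x) = hterm_bar x.
Proof. exact/hterm_bar_rel/hclass_reprP. Qed.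

Fact hecke_barD x y : hecke_bar (x + y) = hecke_bar x + hecke_bar y.
Proof.
by elim/heckeW: x => x; elim/heckeW: y => y; rewrite -hclassDE !hecke_barE.
Qed.

Fact hecke_bar_is_zmod_morphism : zmod_morphism hecke_bar.
Proof.
move=> x y; apply: (addIr (hecke_bar y)).
by rewrite -hecke_barD !subrK.
Qed.

Fact hecke_bar_is_monoid_morphism : monoid_morphism hecke_bar.
Proof.
split=> [|x y]; first by rewrite -[X in hecke_bar X]/(hclass (HScal 1)) hecke_barE /= rmorph1 scale1r.
by elim/heckeW: x => x; elim/heckeW: y => y; rewrite -hclassME !hecke_barE.
Qed.

HB.instance Definition _ := GRing.isZmodMorphism.Build hecke hecke
  hecke_bar hecke_bar_is_zmod_morphism.
HB.instance Definition _ := GRing.isMonoidMorphism.Build hecke hecke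
  hecke_bar hecke_bar_is_monoid_morphism.

Lemma hecke_barZ (a : laurent) x : hecke_bar (a *: x) = lbar a *: hecke_bar x.
Proof.
by rewrite -mulr_algl rmorphM /= -hclassS hecke_barE /= mulr_algl.
Qed.

Lemma hecke_bar_gen s : hecke_bar (hecke_gen s) = hecke_genV s.
Proof. exact: hecke_barE. Qed.

Lemma hecke_bar_wordK w : hecke_bar (hecke_word w) * hecke_word (rev w) = 1.
Proof. by rewrite -(hclass_word w) hecke_barE hterm_bar_word hecke_wordVK. Qed.

Lemma hecke_bar_wordKV w : hecke_word (rev w) * hecke_bar (hecke_word w) = 1.
Proof. by rewrite -(hclass_word w) hecke_barE hterm_bar_word hecke_wordKV. Qed.

Lemma hecke_sgnD x y : hecke_sgn (x + y) = hecke_sgn x + hecke_sgn y.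
Proof.
by elim/heckeW: x => x; elim/heckeW: y => y; rewrite -hclassDE !hecke_sgnE.
Qed.

Lemma hecke_sgnM x y : hecke_sgn (x * y) = hecke_sgn x * hecke_sgn y.
Proof.
by elim/heckeW: x => x; elim/heckeW: y => y; rewrite -hclassME !hecke_sgnE.
Qed.

Lemma hecke_sgnS a : hecke_sgn a%:A = a.
Proof. by rewrite -hclassS hecke_sgnE. Qed.

Lemma hecke_sgn_gen s : hecke_sgn (hecke_gen s) = - lq.
Proof. by rewrite hecke_sgnE. Qed.

Lemma hecke_sgn_bar x : hecke_sgn (hecke_bar x) = lbar (hecke_sgn x).
Proof.
elim/heckeW: x; elim=> [s|a|x IHx y IHy|x IHx y IHy].
- rewrite -/(hecke_gen s) hecke_bar_gen hecke_sgnD hecke_sgn_gen hecke_sgnS.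
  by rewrite rmorphN /= lbarq addrA addNr add0r.
- by rewrite hclassS hecke_barZ rmorph1 !hecke_sgnS.
- by rewrite hclassDE rmorphD !hecke_sgnD IHx IHy rmorphD.
- by rewrite hclassME rmorphM !hecke_sgnM IHx IHy rmorphM.
Qed.

End Hecke.

(* -------------------------------------------------------------------------- *)
(* The antispherical module Z[q, q^-1] (x)_{H^Theta} H, as the abelian group  *)
(* generated by the symbols a (x) h modulo biadditivity and                   *)
(* (a . g) (x) h = a (x) (g * h) for g in H^Theta. The right action a . g is  *)
(* a * hecke_sgn g: on H^Theta, hecke_sgn is the character H_s |-> -q.        *)
(* -------------------------------------------------------------------------- *)

Section Antispherical.
Variables (I : finType) (m : I -> I -> nat) (Theta : {set I}).
Local Notation H := (hecke m).

Inductive hecke_parabolic : H -> Prop :=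
  | hpar_gen s : s \in Theta -> hecke_parabolic (hecke_gen m s)
  | hpar_scal a : hecke_parabolic a%:A
  | hpar_add x y :
      hecke_parabolic x -> hecke_parabolic y -> hecke_parabolic (x + y)
  | hpar_mul x y :
      hecke_parabolic x -> hecke_parabolic y -> hecke_parabolic (x * y).

Lemma hecke_parabolic_bar x : hecke_parabolic x -> hecke_parabolic (hecke_bar x).
Proof.
elim=> {x} [s hs|a|x y _ hx _ hy|x y _ hx _ hy].
- by rewrite hecke_bar_gen; apply: hpar_add; [apply: hpar_gen|apply: hpar_scal].
- by rewrite hecke_barZ rmorph1; apply: hpar_scal.
- by rewrite rmorphD; apply: hpar_add.
- by rewrite rmorphM; apply: hpar_mul.
Qed.

Inductive tterm : Type :=
  | TPure of laurent & H
  | TZero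
  | TOpp of tterm
  | TAdd of tterm & tterm.

Inductive trel : tterm -> tterm -> Prop :=
  | trel_refl x : trel x x
  | trel_sym x y : trel x y -> trel y x
  | trel_trans x y z : trel x y -> trel y z -> trel x z
  | trel_opp x x' : trel x x' -> trel (TOpp x) (TOpp x')
  | trel_add x x' y y' : trel x x' -> trel y y' -> trel (TAdd x y) (TAdd x' y')
  | trel_addA x y z : trel (TAdd x (TAdd y z)) (TAdd (TAdd x y) z)
  | trel_addC x y : trel (TAdd x y) (TAdd y x)
  | trel_add0 x : trel (TAdd TZero x) x
  | trel_addN x : trel (TAdd (TOpp x) x) TZero
  | trel_pureDl a b h : trel (TPure (a + b) h) (TAdd (TPure a h) (TPure b h))
  | trel_pureDr a h g : trel (TPure a (h + g)) (TAdd (TPure a h) (TPure a g))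
  | trel_balanced a g h : hecke_parabolic g ->
      trel (TPure (a * hecke_sgn g) h) (TPure a (g * h)).

HB.instance Definition _ := gen_eqMixin tterm.
HB.instance Definition _ := gen_choiceMixin tterm.

Definition tequiv (x y : tterm) : bool := `[< trel x y >].

Fact tequiv_refl : reflexive tequiv.
Proof. by move=> x; apply/asboolP; apply: trel_refl. Qed.

Fact tequiv_sym : symmetric tequiv.
Proof. by move=> x y; apply/asboolP/asboolP; apply: trel_sym. Qed.

Fact tequiv_trans : transitive tequiv.
Proof.
by move=> y x z /asboolP h1 /asboolP h2; apply/asboolP; apply: trel_trans h1 h2.
Qed.

Canonical tequiv_equiv := EquivRel tequiv tequiv_refl tequiv_sym tequiv_trans.

Definition antispherical := {eq_quot tequiv}.

HB.instance Definition _ : EqQuotient tterm tequiv antispherical :=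
  EqQuotient.on antispherical.
HB.instance Definition _ := Choice.on antispherical.

Definition tclass (x : tterm) : antispherical := \pi_antispherical x.

Lemma tclassP x y : tclass x = tclass y <-> trel x y.
Proof.
split=> [/eqmodP/asboolP //|h]; apply/eqmodP; exact/asboolP.
Qed.

Lemma tclass_repr (x : antispherical) : tclass (repr x) = x.
Proof. exact: reprK. Qed.

Lemma tclass_reprP x : trel (repr (tclass x)) x.
Proof. by apply/tclassP; rewrite tclass_repr. Qed.

Lemma tclassW (P : antispherical -> Prop) : (forall x, P (tclass x)) -> forall x, P x.
Proof. by move=> h x; rewrite -(tclass_repr x). Qed.

Definition tens_add (x y : antispherical) := tclass (TAdd (repr x) (repr y)).
Definition tens_opp (x : antispherical) := tclass (TOpp (repr x)).

Lemma tclassD x y : tclass (TAdd x y) = tens_add (tclass x) (tclass y).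
Proof. by apply/tclassP/trel_sym/trel_add; apply: tclass_reprP. Qed.

Lemma tclassN x : tclass (TOpp x) = tens_opp (tclass x).
Proof. by apply/tclassP/trel_sym/trel_opp; apply: tclass_reprP. Qed.

Fact tens_addA : associative tens_add.
Proof.
elim/tclassW=> x; elim/tclassW=> y; elim/tclassW=> z; rewrite -!tclassD.
exact/tclassP/trel_addA.
Qed.

Fact tens_addC : commutative tens_add.
Proof.
by elim/tclassW=> x; elim/tclassW=> y; rewrite -!tclassD; exact/tclassP/trel_addC.
Qed.

Fact tens_add0 : left_id (tclass TZero) tens_add.
Proof. by elim/tclassW=> x; rewrite -!tclassD; exact/tclassP/trel_add0. Qed.

Fact tens_addN : left_inverse (tclass TZero) tens_opp tens_add.
Proof.
by elim/tclassW=> x; rewrite -tclassN -tclassD; exact/tclassP/trel_addN.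
Qed.

HB.instance Definition _ := GRing.isZmodule.Build antispherical
  tens_addA tens_addC tens_add0 tens_addN.

(* a (x) h *)
Definition tens (a : laurent) (h : H) : antispherical := tclass (TPure a h).

Lemma tclassDE x y : tclass (TAdd x y) = tclass x + tclass y.
Proof. exact: tclassD. Qed.

Lemma tclassNE x : tclass (TOpp x) = - tclass x.
Proof. exact: tclassN. Qed.

Lemma tensDl a b h : tens (a + b) h = tens a h + tens b h.
Proof. by rewrite /tens -tclassDE; exact/tclassP/trel_pureDl. Qed.

Lemma tensDr a h g : tens a (h + g) = tens a h + tens a g.
Proof. by rewrite /tens -tclassDE; exact/tclassP/trel_pureDr. Qed.

Lemma tens_balanced a g h : hecke_parabolic g ->
  tens (a * hecke_sgn g) h = tens a (g * h).
Proof. by move=> hg; apply/tclassP/trel_balanced. Qed.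

(* A map of generators (a, h) |-> (f a, k h) compatible with the relations    *)
(* descends to the tensor product.                                            *)
Section TensorMap.
Variables (f : laurent -> laurent) (k : H -> H).
Hypothesis fD : forall a b, f (a + b) = f a + f b.
Hypothesis kD : forall h g, k (h + g) = k h + k g.
Hypothesis fk : forall a g h, hecke_parabolic g ->
  tens (f (a * hecke_sgn g)) (k h) = tens (f a) (k (g * h)).

Fixpoint tterm_map (x : tterm) : antispherical :=
  match x with
  | TPure a h => tens (f a) (k h)
  | TZero => 0
  | TOpp x => - tterm_map x
  | TAdd x y => tterm_map x + tterm_map y
  end.

Lemma tterm_map_rel x y : trel x y -> tterm_map x = tterm_map y.
Proof using fD kD fk.
elim=> //= {x y}.
- by move=> x y z _ -> _ ->.
- by move=> x x' _ ->.
- by move=> x x' y y' _ -> _ ->.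
- by move=> x y z; rewrite addrA.
- by move=> x y; rewrite addrC.
- by move=> x; rewrite add0r.
- by move=> x; rewrite addNr.
- by move=> a b h; rewrite fD tensDl.
- by move=> a h g; rewrite kD tensDr.
Qed.
End TensorMap.

Definition tens_scale (c : laurent) (x : antispherical) : antispherical :=
  tterm_map ( *%R c) id (repr x).

Lemma tens_scaleE c x : tens_scale c (tclass x) = tterm_map ( *%R c) id x.
Proof.
apply: tterm_map_rel (tclass_reprP x) => //.
- by move=> a b; rewrite mulrDr.
- by move=> a g h hg; rewrite mulrA tens_balanced.
Qed.

Fact tens_scaleA a b x : tens_scale a (tens_scale b x) = tens_scale (a * b) x.
Proof.
have D c y z : tens_scale c (y + z) = tens_scale c y + tens_scale c z.
  by elim/tclassW: y => y; elim/tclassW: z => z; rewrite -tclassDE !tens_scaleE.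
have N c y : tens_scale c (- y) = - tens_scale c y.
  by elim/tclassW: y => y; rewrite -tclassNE !tens_scaleE.
elim/tclassW: x; elim=> [c h||x IH|x IHx y IHy].
- by rewrite !tens_scaleE /= mulrA.
- by rewrite !tens_scaleE.
- by rewrite tclassNE !N IH.
- by rewrite tclassDE !D IHx IHy.
Qed.

Fact tens_scale1 : left_id 1 tens_scale.
Proof.
elim/tclassW; elim=> [c h||x IH|x IHx y IHy]; rewrite tens_scaleE /=.
- by rewrite mul1r.
- by [].
- by rewrite tclassNE -[in RHS]IH tens_scaleE.
- by rewrite tclassDE -[in RHS]IHx -[in RHS]IHy !tens_scaleE.
Qed.

Fact tens_scaleDr : right_distributive tens_scale +%R.
Proof.
by move=> c; elim/tclassW=> y; elim/tclassW=> z; rewrite -tclassDE !tens_scaleE.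
Qed.

Fact tens_scaleDl x : {morph tens_scale^~ x : a b / a + b}.
Proof.
move=> a b; elim/tclassW: x; elim=> [c h||x IH|x IHx y IHy]; rewrite !tens_scaleE /=.
- by rewrite mulrDl tensDl.
- by rewrite addr0.
- by move: IH; rewrite !tens_scaleE => ->; rewrite opprD.
- by move: IHx IHy; rewrite !tens_scaleE => -> ->; rewrite addrACA.
Qed.

HB.instance Definition _ := GRing.Zmodule_isLmodule.Build laurent antispherical
  tens_scaleA tens_scale1 tens_scaleDr tens_scaleDl.

Lemma scale_tens c a h : c *: tens a h = tens (c * a) h.
Proof. exact: tens_scaleE. Qed.

(* The additive involution bar (a (x) h) = bar a (x) bar h. *)
Definition antispherical_bar (x : antispherical) : antispherical :=
  tterm_map lbar (@hecke_bar I m) (repr x).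

Lemma antispherical_barE x :
  antispherical_bar (tclass x) = tterm_map lbar (@hecke_bar I m) x.
Proof.
apply: tterm_map_rel (tclass_reprP x).
- exact: rmorphD.
- exact: rmorphD.
- move=> a g h hg; rewrite !rmorphM /= -hecke_sgn_bar tens_balanced //.
  exact: hecke_parabolic_bar.
Qed.

Fact antispherical_bar_is_zmod_morphism : zmod_morphism antispherical_bar.
Proof.
elim/tclassW=> x; elim/tclassW=> y.
by rewrite -tclassNE -tclassDE !antispherical_barE.
Qed.

HB.instance Definition _ := GRing.isZmodMorphism.Build antispherical antispherical
  antispherical_bar antispherical_bar_is_zmod_morphism.

Lemma antispherical_bar_tens a h :
  antispherical_bar (tens a h) = tens (lbar a) (hecke_bar h).
Proof. exact: antispherical_barE. Qed.

End Antispherical.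

Record rootSystem (F : realFieldType) (V : vectType F) := RootSystem {
  roots : seq V;
  coroot : V -> 'Hom(V, F^o);
  roots_span : <<roots>>%VS = fullv;
  roots_neq0 : 0 \notin roots;
  coroot2 : forall a, a \in roots -> coroot a a = 2%:R;
  roots_refl : forall a b, a \in roots -> b \in roots ->
    b - coroot a b *: a \in roots;
  coroot_int : forall a b, a \in roots -> b \in roots ->
    exists z : int, coroot a b = z%:~R;
  roots_reduced : forall a (c : F), a \in roots -> c *: a \in roots ->
    c = 1 \/ c = -1
}.

Section Weyl.
Variables (F : realFieldType) (V : vectType F) (Phi : rootSystem V).

Definition rootT : finType := seq_sub (roots Phi).

Definition reflf (a b : rootT) : rootT :=
  SeqSub (roots_refl (valP a) (valP b)).

Fact reflf_inj a : injective (reflf a).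
Proof.
apply: (can_inj (g := reflf a)) => b; apply: val_inj => /=.
have /= e := coroot2 (valP a); set c := coroot _ _ (val b).
have -> : coroot Phi (val a) (val b - c *: val a) = - c.
  rewrite linearB [X in _ - X]linearZ /= e -/c.
  by rewrite [_ *: _]mulr_natr mulr2n opprD addNKr.
by rewrite scaleNr opprK subrK.
Qed.

(* Elements of the Weyl group are represented by the permutations of the      *)
(* roots they induce (the roots span V, so this is faithful). The product of  *)
(* {perm T} is x * y = y \o x, so what is obtained is the opposite of the     *)
(* group of linear maps; w |-> w^-1 is an isomorphism between the two that    *)
(* fixes all reflections.                                                     *)
Definition refl (a : rootT) : {perm rootT} := perm (@reflf_inj a).

Definition weyl : {group {perm rootT}} := <<[set refl a | a : rootT]>>%G.

Definition is_base (Pi : {set rootT}) : Prop :=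
  free [seq val a | a <- enum Pi] /\
  forall b : rootT, exists n : rootT -> nat,
    val b = \sum_(a in Pi) (n a)%:R *: val a
    \/ val b = - \sum_(a in Pi) (n a)%:R *: val a.

Variable Pi : {set rootT}.

Definition simple : finType := {a : rootT | a \in Pi}.

Definition srefl (a : simple) : {perm rootT} := refl (val a).

Definition word_prod (u : seq simple) : {perm rootT} := (\prod_(a <- u) srefl a)%g.

Definition has_word (x : {perm rootT}) : pred nat :=
  fun k => [exists u : k.-tuple simple, word_prod u == x].

(* The default value 0 is never reached on the Weyl group. *)
Definition len (x : {perm rootT}) : nat :=
  if pselect (exists k, has_word x k) is left h then ex_minn h else 0.

Definition reduced_word (x : {perm rootT}) : seq simple :=
  if [pick u : (len x).-tuple simple | word_prod u == x] is Some u
  then val u else [::].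

(* Generated by x < x t for t any reflection, simple or not, when the length
   increases. *)
Definition bruhat : rel {perm rootT} :=
  connect [rel x y | (len x < len y)%N && [exists a : rootT, y == (x * refl a)%g]].

(* fingroup.repr A is an element of A when A is nonempty. *)
Definition longest (A : {set {perm rootT}}) : {perm rootT} :=
  [arg max_(x > fingroup.repr A in A) len x].

Definition coxeter_mx (a b : simple) : nat := #[srefl a * srefl b]%g.

(* By the braid relations, H_w is independent of the reduced expression. *)
Definition hecke_basis (x : {perm rootT}) : hecke coxeter_mx :=
  hecke_word coxeter_mx (reduced_word x).

Variable Theta : {set simple}.

Definition weyl_par : {group {perm rootT}} := <<[set srefl a | a in Theta]>>%G.

(* MathComp's right cosets W_Theta :* w = {x w | x in W_Theta} *)
Definition wcoset : finType :=
  {C : {set {perm rootT}} | C \in rcosets weyl_par weyl}.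

Fact coset_srefl_subproof (C : wcoset) (a : simple) :
  (val C :* srefl a)%g \in rcosets weyl_par weyl.
Proof.
case/rcosetsP: (valP C) => x xW ->; apply/rcosetsP.
exists (x * srefl a)%g; last by rewrite rcosetM.
by rewrite groupM // mem_gen //; apply/imsetP; exists (val a).
Qed.

Definition coset_srefl (C : wcoset) (a : simple) : wcoset :=
  exist (fun D => D \in rcosets weyl_par weyl) _ (coset_srefl_subproof C a).

Definition coset_le (C D : wcoset) : bool :=
  bruhat (longest (val C)) (longest (val D)).

Definition coset_lt (C D : wcoset) : bool := (C != D) && coset_le C D.

Definition coset_module := {ffun wcoset -> laurent^o}.

Definition delta (C : wcoset) : coset_module := [ffun D => (D == C)%:R].

(* If Cs <> C, exactly one of C < Cs and Cs < C holds. *)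
Definition T_delta (a : simple) (C : wcoset) : coset_module :=
  let Cs := coset_srefl C a in
  if Cs == C then 0
  else if coset_lt C Cs then lq *: delta C + delta Cs
  else lqV *: delta C + delta Cs.

Definition T_op (a : simple) (E : coset_module) : coset_module :=
  \sum_C (E C : laurent) *: T_delta a C.

(* w_Theta * w^C is the shortest element of C. *)
Definition coset_iso (E : coset_module) : antispherical coxeter_mx Theta :=
  \sum_C (E C : laurent) *:
    tens Theta 1 (hecke_basis (longest weyl_par * longest (val C))%g).

Definition self_dual (E : coset_module) : Prop :=
  antispherical_bar (coset_iso E) = coset_iso E.

End Weyl.

(* Main.v *)
(* Write iso for the isomorphism delta_C |-> N_C, where N_C = 1 (x) H_y for the
   shortest element y of C. It turns T_alpha into right multiplication by
   H_{s_alpha} + q, which is bar-invariant; hence T_alpha preserves self-duality.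

   If (i) holds and C is not W_Theta, choose alpha with C s < C. In the expansion
   of T_alpha (phi (C s)) the coefficient of phi C is 1, so phi C is the
   difference of a self-dual element and of an integral combination of the phi D,
   D < C, and induction applies. Conversely, the lifting property of the Bruhat
   order and unitriangularity give T_alpha (phi (C s)) = sum_{D <= C} c_D phi D
   with c_D in Z[q]; if all phi D are self-dual, then so is the left-hand side,
   hence bar c_D = c_D and c_D is an integer. This comparison of coefficients
   needs the N_C to be linearly independent: a (x) h |-> a (e h), where
   e = sum_{p in W_Theta} (-q)^{l(p)} H_p, maps them to elements of the regular
   module with disjoint supports. *)

Require Import Defs.
From HB Require Import structures.
From mathcomp Require Import all_boot all_order all_algebra all_fingroup.
From mathcomp Require Import generic_quotient boolp cyclic zify ring.

Set Implicit Arguments.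
Unset Strict Implicit.
Unset Printing Implicit Defensive.

Import Order.TTheory GRing.Theory Num.Theory.
Local Open Scope ring_scope.

(** * Reflections *)

(** The Weyl group is given as a permutation group generated by all reflections, its length counts
    simple ones, and the coroots come with no equivariance under [W]. The Coxeter theory is
    therefore derived from signs of roots. Since [x * y] is [y \o x], right multiplication by
    [srefl a] lengthens [x] exactly when [x^-1 a] is positive, and left multiplication exactly when
    [x a] is. [H_w] is defined by one chosen reduced word, so Matsumoto's theorem is needed before
    basis elements can be multiplied. The Hecke algebra is given by generators and relations, and a
    presentation alone says nothing about linear independence: a concrete right action has to be
    checked against the relations. The braid relation is the difficult one, and it rests on the same
    analysis of the subgroups generated by two simple reflections as Matsumoto's theorem. *)

Section Reflections.
Variables (F : realFieldType) (V : vectType F) (Phi : rootSystem V).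
Implicit Types (a b : rootT Phi) (x y : {perm rootT Phi}).
Local Notation W := (weyl Phi).

Definition rootN b := refl b b.

Definition pairing a (v : V) : F := coroot Phi (val a) v.

Lemma pairing_linear a c u v :
  pairing a (c *: u + v) = c * pairing a u + pairing a v.
Proof. by rewrite /pairing linearP. Qed.

Lemma pairing_root a : pairing a (val a) = 2%:R.
Proof. exact: coroot2 (valP a). Qed.

Lemma val_refl a b : val (refl a b) = val b - pairing a (val b) *: val a.
Proof. by rewrite permE. Qed.

Lemma val_rootN b : val (rootN b) = - val b.
Proof. by rewrite val_refl pairing_root scaler_nat mulr2n opprD addNKr. Qed.

Lemma root_neq0 b : val b != 0.
Proof. by apply: contraNneq (roots_neq0 Phi) => <-; apply: (valP b). Qed.

Lemma reflK a : (refl a * refl a = 1)%g.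
Proof.
apply/permP => b; rewrite permM perm1; apply: val_inj.
rewrite !val_refl; set c := pairing a (val b).
have -> : pairing a (val b - c *: val a) = - c.
  rewrite -scaleNr addrC pairing_linear pairing_root -/c mulNr mulr_natr.
  by rewrite mulr2n opprD subrK.
by rewrite scaleNr opprK subrK.
Qed.

Lemma reflV a : ((refl a)^-1 = refl a)%g.
Proof. by apply: (mulgI (refl a)); rewrite mulgV reflK. Qed.

(* If the functionals differ, the product of the two reflections translates
   some root by a nonzero vector, so it has infinite order. *)
Lemma refl_uniq b (p : {perm rootT Phi}) (h : V -> F) :
  (forall c u v, h (c *: u + v) = c * h u + h v) -> h (val b) = 2%:R ->
  (forall c, val (p c) = val c - h (val c) *: val b) -> p = refl b.
Proof.
move=> hl hb hp; apply/permP => c; apply: val_inj; rewrite hp val_refl.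
congr (_ - _ *: _); pose k v := pairing b v - h v.
have kD v t : k (t *: val b + v) = k v.
  by rewrite /k hl pairing_linear hb pairing_root opprD addrACA subrr add0r.
have step d : val ((refl b * p)%g d) = k (val d) *: val b + val d.
  rewrite permM hp.
  have -> : val (refl b d) = - pairing b (val d) *: val b + val d.
    by rewrite val_refl scaleNr addrC.
  rewrite hl hb addrAC -scalerBl /k; congr (_ *: _ + _).
  ring.
have iter n : val (((refl b * p) ^+ n)%g c) = (n%:R * k (val c)) *: val b + val c.
  elim: n => [|n IH]; first by rewrite perm1 mul0r scale0r add0r.
  by rewrite expgSr permM step IH kD addrA -scalerDl -natr1 mulrDl mul1r [_ + k _]addrC.
have := iter #[refl b * p]%g; rewrite expg_order perm1 => /eqP.
rewrite -subr_eq0 opprD addrCA subrr addr0 oppr_eq0.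
rewrite scaler_eq0 (negPf (root_neq0 b)) orbF mulf_eq0 pnatr_eq0.
by rewrite eqn0Ngt order_gt0 /= subr_eq0 => /eqP->.
Qed.

(** Recovers the linear map behind a permutation of the roots; arguments about cones and
    coefficients need linearity. *)
Lemma weyl_linear x : x \in W ->
  exists f : V -> V, linear f /\ forall b, val (x b) = f (val b).
Proof.
move=> /gen_prodgP[n [c hc ->]].
elim: n c hc => [|n IH] c hc.
  by rewrite big_ord0; exists id; split=> // b; rewrite perm1.
rewrite big_ord_recl; have /imsetP[a _ ->] := hc ord0.
have [f [fl hf]] := IH (fun i => c (lift ord0 i)) (fun i => hc _).
exists (fun v => f (v - pairing a v *: val a)); split=> [t u v|b].
  rewrite -fl pairing_linear; congr (f _).
  by rewrite scalerBr scalerA scalerDl opprD addrACA.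
by rewrite permM hf val_refl.
Qed.

Lemma weylN x b : x \in W -> x (rootN b) = rootN (x b).
Proof.
move=> /weyl_linear[f [fl hf]]; apply: val_inj; rewrite hf !val_rootN hf.
have f0 : f 0 = 0.
  by apply: (addrI (f 0)); rewrite addr0 -{1}[f 0]scale1r -fl scale1r addr0.
by rewrite -[- val b]addr0 -scaleN1r fl f0 addr0 scaleN1r.
Qed.

Lemma refl_in a : refl a \in W.
Proof. exact/mem_gen/imset_f. Qed.

(** No assumption relates the coroots of [b] and [x b]. The conjugate reflects along [x b] by the
    functional of [b] composed with the inverse of [x], and [refl_uniq] identifies it. *)
Lemma refl_conj x b : x \in W -> refl (x b) = (refl b ^ x)%g.
Proof.
move=> xW; have [f [fl hf]] := weyl_linear xW.
have [g [gl hg]] := weyl_linear (groupVr xW).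
have fg (c : rootT Phi) : f (g (val c)) = val c by rewrite -hg -hf permKV.
have gf : g (val (x b)) = val b by rewrite -hg permK.
apply/esym/(@refl_uniq _ _ (fun v => pairing b (g v))).
- by move=> c u v; rewrite gl pairing_linear.
- by rewrite gf pairing_root.
move=> c; rewrite conjgE !permM hf.
have -> : val (refl b (x^-1 c)%g) = - pairing b (g (val c)) *: val b + g (val c).
  by rewrite val_refl hg scaleNr addrC.
by rewrite fl fg -hf scaleNr addrC.
Qed.

Lemma mul_refl x b : x \in W -> (x * refl (x b) = refl b * x)%g.
Proof. by move=> xW; rewrite refl_conj // conjgE !mulgA mulgV mul1g. Qed.

End Reflections.

(** * Positive roots *)

Section PositiveRoots.
Variables (F : realFieldType) (V : vectType F) (Phi : rootSystem V).
Variables (Pi : {set rootT Phi}) (hPi : is_base Pi).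
Implicit Types (a : simple Pi) (b : rootT Phi) (x y : {perm rootT Phi}).
Implicit Types (A B : {set simple Pi}) (u : seq (simple Pi)).
Local Notation W := (weyl Phi).

Definition comb (n : simple Pi -> F) : V := \sum_a n a *: val (val a).

Lemma comb_eq n k : comb n = comb k -> n =1 k.
Proof using hPi.
case: hPi => /freeP fr _ e a.
pose s := [seq val b | b <- enum Pi].
pose g (b : rootT Phi) : F :=
  if insub b is Some a' then n a' - k a' else 0.
have gE a' : g (val a') = n a' - k a' by rewrite /g valK.
have e0 : \sum_(b in Pi) g b *: val b = 0.
  rewrite big_sub; apply/eqP.
  have <- : comb n - comb k = \sum_(a' : simple Pi) g (val a') *: val (val a').
    by rewrite /comb -sumrB; apply: eq_bigr => a' _; rewrite gE scalerBl.
  by rewrite e subrr.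
have ha := valP a.
pose i0 := enum_rank_in ha (val a).
have /(fr (fun i => g (nth (val a) (enum Pi) i))) :
    \sum_(i < #|Pi|) g (nth (val a) (enum Pi) i) *: s`_i = 0.
  rewrite -[RHS]e0 -[in RHS]big_enum /= (big_nth (val a)) big_mkord -cardE.
  by apply: eq_bigr => i _; rewrite (nth_map (val a)) // -cardE.
have lt : (index (val a) (enum Pi) < #|Pi|)%N.
  by rewrite cardE index_mem mem_enum.
move=> /(_ (Ordinal lt)) /=; rewrite nth_index ?mem_enum // gE => /eqP.
by rewrite subr_eq0 => /eqP.
Qed.

Definition cone A (v : V) : Prop := exists n : simple Pi -> nat,
  (forall a, a \notin A -> n a = 0%N) /\ v = comb (fun a => (n a)%:R).

Definition pos b : bool := `[< cone [set: simple Pi] (val b) >].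

Lemma coneN A B v : cone A v -> cone B (- v) -> v = 0.
Proof using hPi.
move=> [n [_ hn]] [k [_ hk]].
have /comb_eq nk : comb (fun a => (n a)%:R + (k a)%:R) = comb (fun=> 0).
  rewrite [RHS]big1; last by move=> a _; rewrite scale0r.
  rewrite -(subrr v) hk {1}hn /comb -big_split.
  by apply: eq_bigr => a _; rewrite scalerDl.
rewrite hn /comb big1 // => a _; move/eqP: (nk a).
by rewrite -natrD pnatr_eq0 addn_eq0 => /andP[/eqP-> _]; rewrite scale0r.
Qed.

Lemma cone_sub A B v : A \subset B -> cone A v -> cone B v.
Proof.
move=> /subsetP AB [n [h ->]]; exists n; split=> // a aB; apply: h.
by apply: contra aB; apply: AB.
Qed.

Lemma pos_cone A b : cone A (val b) -> pos b.
Proof. by move=> h; apply/asboolP; apply: cone_sub h; apply: subsetT. Qed.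

Lemma posNcone A b : cone A (- val b) -> pos b = false.
Proof using hPi.
move=> h; apply/negbTE/asboolPn => h'; have := root_neq0 b.
by rewrite (coneN h' h) eqxx.
Qed.

Lemma posN b : pos (rootN b) = ~~ pos b.
Proof using hPi.
have [_ /(_ b)[n h]] := hPi.
have c : cone [set: simple Pi] (\sum_(a in Pi) (n a)%:R *: val a).
  exists (n \o val); split=> [a|]; first by rewrite inE.
  by rewrite big_sub.
case: h => h.
  have pb : pos b by apply/asboolP; rewrite h.
  by rewrite pb; apply: (@posNcone [set: _]); rewrite val_rootN opprK h.
have -> : pos (rootN b) by apply/asboolP; rewrite val_rootN h opprK.
by rewrite (@posNcone [set: _]) // h opprK.
Qed.

Lemma comb_delta a : comb (fun a' => (a' == a)%:R) = val (val a).
Proof.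
rewrite /comb (bigD1 a) //= eqxx scale1r big1 ?addr0 // => a' /negPf ->.
by rewrite scale0r.
Qed.

Lemma cone_simple A a : a \in A -> cone A (val (val a)).
Proof.
move=> aA; exists (fun a' => (a' == a)); split=> [a'|]; last by rewrite comb_delta.
by apply: contraNeq; rewrite eqb0 negbK => /eqP ->.
Qed.

Lemma pos_simple a : pos (val a).
Proof. exact/pos_cone/(@cone_simple [set: _])/in_setT. Qed.

Lemma comb_refl a b n : val b = comb n ->
  val (srefl a b) = comb (fun a' => n a' - (a' == a)%:R * pairing (val a) (val b)).
Proof.
move=> h; rewrite /srefl val_refl h /comb.
rewrite -[in X in _ - X]comb_delta /comb scaler_sumr -sumrB.
by apply: eq_bigr => a' _; rewrite scalerBl scalerA mulrC.
Qed.

(** The reflection changes only the coefficient of [a], so any other nonzero coefficient of [b]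
    stays positive and decides the sign. If there is none, [b] is a multiple of [a], and reducedness
    leaves only [b = a]. *)
Lemma srefl_pos a b : pos b -> b != val a -> pos (srefl a b).
Proof using hPi.
move=> /asboolP[n [_ hn]] ba.
have [/existsP[a' /andP[a'a na']]|/existsPn n0] :=
    boolP [exists a', (a' != a) && (n a' != 0)].
- apply: contraT => hneg.
  have /asboolP[k [_ hk]] : pos (rootN (srefl a b)) by rewrite posN.
  have := comb_refl a hn; set p := pairing _ _ => e.
  have /comb_eq/(_ a') : comb (fun a'' => (k a'')%:R) =
                    comb (fun a'' => - ((n a'')%:R - (a'' == a)%:R * p)).
    rewrite -hk val_rootN e /comb -sumrN.
    by apply: eq_bigr => i _; rewrite scaleNr.
  rewrite (negPf a'a) mul0r subr0 => /eqP; rewrite -subr_eq0 opprK -natrD.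
  by rewrite pnatr_eq0 addn_eq0 (negPf na') andbF.
have nb : val b = (n a)%:R *: val (val a).
  rewrite hn /comb (bigD1 a) //= big1 ?addr0 // => a' a'a.
  by have := n0 a'; rewrite a'a /= negbK => /eqP ->; rewrite scale0r.
have [] := @roots_reduced _ _ Phi (val (val a)) (n a)%:R.
- exact: (valP (val a)).
- by rewrite -nb; apply: (valP b).
- move=> e; case/eqP: ba; apply: val_inj; rewrite nb e scale1r //.
move/eqP; rewrite -subr_eq0 opprK natr1 pnatr_eq0 //.
Qed.

End PositiveRoots.

(** * Length and the exchange property *)

Section Length.
Variables (F : realFieldType) (V : vectType F) (Phi : rootSystem V).
Variables (Pi : {set rootT Phi}) (hPi : is_base Pi).
Implicit Types (a : simple Pi) (b : rootT Phi) (x y : {perm rootT Phi}).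
Implicit Types (A B : {set simple Pi}) (u v : seq (simple Pi)).
Local Notation W := (weyl Phi).
Local Notation len := (len Pi).
Local Notation pos := (pos Pi).

Lemma word_prod_nil : word_prod ([::] : seq (simple Pi)) = 1%g.
Proof. by rewrite /word_prod big_nil. Qed.

Lemma word_prod_cons a u : word_prod (a :: u) = (srefl a * word_prod u)%g.
Proof. by rewrite /word_prod big_cons. Qed.

Lemma word_prod_cat u v : word_prod (u ++ v) = (word_prod u * word_prod v)%g.
Proof. by rewrite /word_prod big_cat. Qed.

Lemma word_prod_rcons u a : word_prod (rcons u a) = (word_prod u * srefl a)%g.
Proof. by rewrite -cats1 word_prod_cat word_prod_cons word_prod_nil mulg1. Qed.

Lemma sreflK a : (srefl a * srefl a = 1)%g. Proof. exact: reflK. Qed.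

Lemma sreflV a : ((srefl a)^-1 = srefl a)%g. Proof. exact: reflV. Qed.

Lemma srefl_in a : srefl a \in W. Proof. exact: refl_in. Qed.

Lemma mulsreflK a x : (x * srefl a * srefl a = x)%g.
Proof. by rewrite -mulgA sreflK mulg1. Qed.

Lemma word_prod_rev u : word_prod (rev u) = (word_prod u)^-1%g.
Proof.
elim: u => [|a u IH]; first by rewrite word_prod_nil invg1.
by rewrite rev_cons word_prod_rcons word_prod_cons IH invMg sreflV.
Qed.

Lemma word_prod_in u : word_prod u \in W.
Proof.
elim: u => [|a u IH]; first by rewrite word_prod_nil group1.
by rewrite word_prod_cons groupM ?srefl_in.
Qed.

(* [x^-1] appears because the product of permutations is [x * y = y \o x]. *)
Lemma exchange u b : pos b -> ~~ pos ((word_prod u)^-1%g b) ->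
  exists u1 a u2, u = u1 ++ a :: u2 /\ (word_prod u * refl b)%g = word_prod (u1 ++ u2).
Proof using hPi.
elim/last_ind: u b => [|u s IH] b pb.
  by rewrite word_prod_nil invg1 perm1 pb.
rewrite word_prod_rcons invMg sreflV permM => h.
have [e|ne] := eqVneq b (val s).
  exists u, s, [::]; rewrite cats1 cats0 e; split=> //.
  by rewrite -/(srefl s) mulsreflK.
have [u1 [a [u2 [e1 e2]]]] := IH _ (srefl_pos hPi pb ne) h.
exists u1, a, (rcons u2 s); split; first by rewrite e1 rcons_cat.
rewrite -rcons_cat word_prod_rcons -e2 refl_conj ?srefl_in //.
by rewrite conjgE sreflV !mulgA mulsreflK.
Qed.

Lemma exchange_size u b : pos b -> ~~ pos ((word_prod u)^-1%g b) ->
  exists u', (size u' < size u)%N /\ (word_prod u * refl b)%g = word_prod u'.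
Proof using hPi.
move=> pb /(exchange pb)[u1 [a [u2 [-> e]]]]; exists (u1 ++ u2); split=> //.
by rewrite !size_cat /= addnS.
Qed.

Lemma has_wordP x k :
  reflect (exists u, size u = k /\ word_prod u = x) (has_word Pi x k).
Proof.
apply: (iffP existsP) => [[u /eqP h]|[u [su h]]].
  by exists u; rewrite size_tuple.
by exists (tcast su (in_tuple u)); rewrite val_tcast h.
Qed.

Lemma len_word_le u : (len (word_prod u) <= size u)%N.
Proof.
rewrite /Defs.len; case: pselect => [h|//].
by case: ex_minnP => m _; apply; apply/has_wordP; exists u.
Qed.

Lemma len_wordP u : exists v, size v = len (word_prod u) /\ word_prod v = word_prod u.
Proof.
rewrite /Defs.len; case: pselect => [h|[]]; last first.
  by exists (size u); apply/has_wordP; exists u.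
by case: ex_minnP => m /has_wordP.
Qed.

Lemma len_wordN u b : pos b -> ~~ pos ((word_prod u)^-1%g b) ->
  (len (word_prod u * refl b) < len (word_prod u))%N.
Proof using hPi.
have [v [<- <-]] := len_wordP u => pb /(exchange_size pb)[u' [lt ->]].
exact: leq_ltn_trans (len_word_le _) lt.
Qed.

Lemma cone_map A (f : V -> V) b : linear f ->
  (forall a, a \in A -> cone [set: simple Pi] (f (val (val a)))) ->
  cone A (val b) -> cone [set: simple Pi] (f (val b)).
Proof.
move=> fl hA [n [hn ->]].
pose fL := GRing.isLinear.Build _ _ _ _ f fl.
pose g : {linear V -> V} := HB.pack f fL.
rewrite -[f _]/(g _) /comb linear_sum.
pose P (v : V) := cone [set: simple Pi] v.
have P0 : P 0.
  exists (fun=> 0%N); split=> //; rewrite /comb big1 // => a _.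
  by rewrite scale0r.
have PD (v w : V) : P v -> P w -> P (v + w).
  move=> [k [_ ->]] [l [_ ->]]; exists (fun a => k a + l a)%N; split=> [a|].
    by rewrite inE.
  by rewrite /comb -big_split; apply: eq_bigr => a _; rewrite natrD scalerDl.
apply: (big_ind P) => // a _; rewrite linearZ /=.
have [aA|/hn ->] := boolP (a \in A); last by rewrite scale0r.
elim: (n a) => [|m IH]; first by rewrite scale0r.
by rewrite -natr1 scalerDl scale1r; apply: PD => //; apply: hA.
Qed.

Lemma cone_pos x A b : x \in W -> (forall a, a \in A -> pos (x (val a))) ->
  cone A (val b) -> pos (x b).
Proof.
move=> /weyl_linear[f [fl hf]] hA hb; apply/asboolP; rewrite hf.
by apply: cone_map hb => // a /hA /asboolP; rewrite hf.
Qed.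

Lemma cone_neg x A b : x \in W -> (forall a, a \in A -> ~~ pos (x (val a))) ->
  cone A (val b) -> ~~ pos (x b).
Proof using hPi.
move=> xW hA hb; have [f [fl hf]] := weyl_linear xW.
rewrite -posN //; apply/asboolP; rewrite val_rootN hf.
have fNl : linear (fun t : V => - f t) by move=> c w w'; rewrite fl opprD scalerN.
apply: (cone_map fNl) hb => a /hA.
by rewrite -posN // => /asboolP; rewrite val_rootN hf.
Qed.

Lemma gen_word x : x \in <<[set srefl a | a : simple Pi]>>%g -> exists u, x = word_prod u.
Proof.
move=> /gen_prodgP[n [c hc ->]]; elim: n c hc => [|n IH] c hc.
  by exists [::]; rewrite big_ord0 word_prod_nil.
rewrite big_ord_recl; have /imsetP[a _ ->] := hc ord0.
have [u ->] := IH (fun i => c (lift ord0 i)) (fun i => hc _).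
by exists (a :: u); rewrite word_prod_cons.
Qed.

(* An element of maximal length of the subgroup generated by the simple
   reflections makes every positive root negative, so the exchange property
   applies to it and to every reflection. *)
Lemma weyl_gen : weyl Phi = <<[set srefl a | a : simple Pi]>>%G.
Proof using hPi.
pose G := <<[set srefl a | a : simple Pi]>>%G.
apply/val_inj/eqP; rewrite eqEsubset -/G; apply/andP; split; last first.
  by apply: genS; apply/subsetP => _ /imsetP[a _ ->]; apply/imsetP; exists (val a).
have GW u : word_prod u \in G.
  elim: u => [|a u IH]; first by rewrite word_prod_nil group1.
  by rewrite word_prod_cons groupM // mem_gen //; apply/imsetP; exists a.
rewrite gen_subG; apply/subsetP => _ /imsetP[b _ ->].
have [x xG xmax] := @arg_maxnP _ 1%g (mem G) len (group1 _).
have [u xu] := gen_word xG.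
have xneg a : ~~ pos (x^-1%g (val a)).
  apply/negP => h.
  have h' : ~~ pos ((word_prod (rcons u a))^-1%g (val a)).
    rewrite word_prod_rcons -xu invMg sreflV permM -/(rootN (val a)).
    by rewrite weylN ?posN ?h // xu groupV word_prod_in.
  have := len_wordN (pos_simple a) h'.
  rewrite -/(srefl a) word_prod_rcons mulsreflK -xu ltnNge; case/negP; apply: xmax.
  by rewrite xu -word_prod_rcons; apply: GW.
have negb c : pos c -> ~~ pos ((word_prod u)^-1%g c).
  move=> /asboolP hc; have uW := groupVr (word_prod_in u).
  by apply: (cone_neg uW _ hc) => a _; rewrite -xu.
wlog pb : b / pos b.
  move=> IH; have [|] := boolP (pos b); first exact: IH.
  rewrite -posN // => /IH.
  by rewrite /rootN refl_conj ?refl_in // conjgE reflK mulg1 reflV.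
have [u' [_ e]] := exchange_size pb (negb _ pb).
by rewrite -(groupMl _ (GW u)) e GW.
Qed.

Lemma weyl_word x : x \in W -> exists u, x = word_prod u /\ size u = len x.
Proof using hPi.
rewrite weyl_gen => /gen_word[u ->]; have [v [<- <-]] := len_wordP u.
by exists v.
Qed.

Lemma len1 : len 1 = 0%N.
Proof. by apply/eqP; rewrite -leqn0 -word_prod_nil len_word_le. Qed.

Lemma len_eq0 x : x \in W -> len x = 0%N -> x = 1%g.
Proof using hPi.
move=> /weyl_word[u [-> <-]] /size0nil ->; exact: word_prod_nil.
Qed.

Lemma lenV x : x \in W -> len x^-1 = len x.
Proof using hPi.
move=> xW; suff le y : y \in W -> (len y^-1 <= len y)%N.
  by apply/eqP; rewrite eqn_leq le //= -{1}(invgK x) le ?groupV.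
move=> /weyl_word[u [-> <-]]; rewrite -word_prod_rev -size_rev.
exact: len_word_le.
Qed.

Lemma len_refl_lt x b : x \in W -> pos b -> ~~ pos (x^-1%g b) ->
  (len (x * refl b) < len x)%N.
Proof using hPi. by move=> /weyl_word[u [-> _]]; apply: len_wordN. Qed.

Lemma len_refl_gt x b : x \in W -> pos b -> pos (x^-1%g b) ->
  (len x < len (x * refl b))%N.
Proof using hPi.
move=> xW pb h; rewrite -[in X in (X < _)%N](mulg1 x) -(reflK b) mulgA.
apply: len_refl_lt => //; first by rewrite groupM ?refl_in.
by rewrite invMg reflV permM -/(rootN b) weylN ?groupV // posN // h.
Qed.

Lemma len_srefl x a : x \in W ->
  if pos (x^-1%g (val a)) then len (x * srefl a) = (len x).+1
  else len x = (len (x * srefl a)).+1.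
Proof using hPi.
have le y : y \in W -> (len (y * srefl a) <= (len y).+1)%N.
  move=> /weyl_word[u [-> <-]]; rewrite -word_prod_rcons -(size_rcons u a).
  exact: len_word_le.
move=> xW; have lt := len_refl_lt xW (pos_simple a).
have gt := len_refl_gt xW (pos_simple a).
case: ifPn => h; apply/eqP; rewrite eqn_leq.
  by apply/andP; split; [apply: le | apply: gt].
apply/andP; split; last exact: lt.
by rewrite -{1}(mulsreflK a x); apply/le/groupM/srefl_in.
Qed.

Lemma len_srefl_left x a : x \in W ->
  if pos (x (val a)) then len (srefl a * x) = (len x).+1
  else len x = (len (srefl a * x)).+1.
Proof using hPi.
move=> xW; have := len_srefl a (groupVr xW); rewrite invgK lenV //.
by rewrite -(lenV (groupM (groupVr xW) (srefl_in a))) invMg invgK sreflV.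
Qed.

End Length.

(** * Bruhat order and parabolic subgroups *)

Section Bruhat.
Variables (F : realFieldType) (V : vectType F) (Phi : rootSystem V).
Variables (Pi : {set rootT Phi}) (hPi : is_base Pi).
Implicit Types (a : simple Pi) (b : rootT Phi) (x y : {perm rootT Phi}).
Local Notation W := (weyl Phi).
Local Notation len := (len Pi).
Local Notation pos := (pos Pi).

Lemma reflN b : refl (rootN b) = refl b.
Proof. by rewrite /rootN refl_conj ?refl_in // conjgE reflK mulg1 reflV. Qed.

Lemma bruhat_refl x b : x \in W -> pos b -> pos (x^-1%g b) ->
  bruhat Pi x (x * refl b)%g.
Proof using hPi.
move=> xW pb h; apply: connect1; rewrite /= len_refl_gt //=.
by apply/existsP; exists b.
Qed.

(** Descends along a Bruhat chain from its top [y]. Each step is normalised to a positive root,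
    since [b] and [rootN b] have the same reflection, and the length condition becomes a sign. *)
Lemma bruhat_ind (P : {perm rootT Phi} -> Prop) y : P y ->
  (forall x b, x \in W -> pos b -> pos (x^-1%g b) ->
     bruhat Pi (x * refl b)%g y -> P (x * refl b)%g -> P x) ->
  forall x, x \in W -> bruhat Pi x y -> P x.
Proof using hPi.
move=> Py step x xW /connectP[p]; elim: p x xW => [|z p IH] x xW /=.
  by move=> _ <-.
move=> /andP[/andP[lt /existsP[b0 /eqP ez]] hp] ey.
have [b pb ezb] : exists2 b, pos b & z = (x * refl b)%g.
  have [h|h] := boolP (pos b0); first by exists b0.
  by exists (rootN b0); rewrite ?posN // reflN.
have zW : z \in W by rewrite ezb groupM ?refl_in.
have hx : pos (x^-1%g b).
  by apply: contraLR lt => h; rewrite -leqNgt ezb ltnW // len_refl_lt.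
apply: (step x b); rewrite -?ezb //; first by apply/connectP; exists p.
exact: IH.
Qed.

Lemma bruhat_len x y : x \in W -> bruhat Pi x y -> x = y \/ (len x < len y)%N.
Proof using hPi.
move=> xW; apply: (bruhat_ind (P := fun x => x = y \/ (len x < len y)%N)) => //.
  by left.
move=> {xW}x b xW pb hx _ IH; right; have lt := len_refl_gt hPi xW pb hx.
by case: IH => [<- //|]; apply: ltn_trans.
Qed.

(** A form of the lifting property. A step [x < x * refl b] with [b] different from [a] is carried
    by [s = srefl a] to the step from [x * s] to [x * s * refl (s b)], because [s b] is still
    positive. A step with [b = a] leads to [x * s] itself, which lies below [y]. *)
Lemma bruhat_srefl x y a : x \in W -> bruhat Pi x y ->
  bruhat Pi (x * srefl a)%g y \/ bruhat Pi (x * srefl a)%g (y * srefl a)%g.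
Proof using hPi.
move: x; apply: bruhat_ind; first by right; apply: connect0.
move=> x b xW pb hx hy IH.
have [e|ne] := eqVneq b (val a); first by left; rewrite /srefl -e.
have e : (x * srefl a * refl (srefl a b) = x * refl b * srefl a)%g.
  by rewrite refl_conj ?srefl_in // conjgE sreflV !mulgA mulsreflK.
have h : bruhat Pi (x * srefl a)%g (x * refl b * srefl a)%g.
  rewrite -e; apply: bruhat_refl; rewrite ?groupM ?srefl_in ?srefl_pos //.
  by rewrite invMg sreflV -permM mulgA sreflK mul1g.
by case: IH => [|] IH; [left|right]; apply: connect_trans h IH.
Qed.

Lemma bruhat_srefl_gt x a : x \in W -> (len x < len (x * srefl a))%N ->
  bruhat Pi x (x * srefl a)%g.
Proof using hPi.
move=> xW lt; apply: bruhat_refl; rewrite ?pos_simple //.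
by apply: contraLR lt => h; rewrite -leqNgt ltnW // len_refl_lt ?pos_simple.
Qed.

End Bruhat.

(** * Parabolic subgroups and their longest elements *)

Section Parabolic.
Variables (F : realFieldType) (V : vectType F) (Phi : rootSystem V).
Variables (Pi : {set rootT Phi}) (hPi : is_base Pi) (A : {set simple Pi}).
Implicit Types (a : simple Pi) (b : rootT Phi) (x y p : {perm rootT Phi}).
Local Notation W := (weyl Phi).
Local Notation WA := (weyl_par A).
Local Notation len := (len Pi).
Local Notation pos := (pos Pi).

Lemma weyl_par_sub p : p \in WA -> p \in W.
Proof.
suff /subsetP : WA \subset W by apply.
rewrite gen_subG; apply/subsetP => _ /imsetP[a _ ->]; exact: srefl_in.
Qed.

Lemma srefl_par a : a \in A -> srefl a \in WA.
Proof. by move=> h; apply/mem_gen/imset_f. Qed.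

Lemma par_ind (P : {perm rootT Phi} -> Prop) : P 1%g ->
  (forall a p, a \in A -> p \in WA -> P p -> P (srefl a * p)%g) ->
  forall p, p \in WA -> P p.
Proof.
move=> P1 step p pA; suff [] : p \in WA /\ P p by [].
case/gen_prodgP: pA => n [c hc ->]; elim: n c hc => [|n IH] c hc.
  by rewrite big_ord0 group1.
rewrite big_ord_recl; have /imsetP[a aA ->] := hc ord0.
have [h1 h2] := IH (fun i => c (lift ord0 i)) (fun i => hc _).
by split; [rewrite groupM ?srefl_par | apply: step].
Qed.

(** Coefficients in [F] without sign condition make the notion stable under [weyl_par A], unlike
    [cone A]. For positive roots the two agree by uniqueness of coefficients. *)
Definition in_span b : Prop := exists n : simple Pi -> F,
  (forall a, a \notin A -> n a = 0) /\ val b = comb n.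

Lemma in_span_simple a : a \in A -> in_span (val a).
Proof.
move=> aA; exists (fun a' => (a' == a)%:R); split=> [a'|]; last by rewrite comb_delta.
by apply: contraNeq; rewrite pnatr_eq0 eqb0 negbK => /eqP ->.
Qed.

Lemma in_span_par p b : p \in WA -> in_span b -> in_span (p b).
Proof.
move=> pA; move: p pA b; apply: par_ind => [b|a p aA _ IH b]; first by rewrite perm1.
move=> [n [n0 hn]]; rewrite permM; apply: IH.
exists (fun a' => n a' - (a' == a)%:R * pairing (val a) (val b)).
split=> [a' a'A|]; last exact: comb_refl.
rewrite n0 // (_ : (a' == a) = false) ?mul0r ?subrr //.
by apply: contraNF a'A => /eqP ->.
Qed.

Lemma in_spanN b : in_span b -> in_span (rootN b).
Proof.
move=> [n [n0 hn]]; exists (fun a => - n a); split=> [a /n0 ->|]; first by rewrite oppr0.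
by rewrite val_rootN hn /comb -sumrN; apply: eq_bigr => a _; rewrite scaleNr.
Qed.

Lemma in_span_cone b : in_span b -> pos b -> cone A (val b).
Proof using hPi.
move=> [n [n0 hn]] /asboolP[k [_ hk]]; exists k; split=> // a /n0.
have /(comb_eq hPi) <- : comb (fun a => (k a)%:R) = comb n by rewrite -hk.
by move=> /eqP; rewrite pnatr_eq0 => /eqP.
Qed.

Lemma in_span_pos y b : y \in W -> (forall a, a \in A -> pos (y (val a))) ->
  in_span b -> pos (y b) = pos b.
Proof using hPi.
move=> yW hy hb; have [pb|] := boolP (pos b).
  exact: cone_pos yW hy (in_span_cone hb pb).
rewrite -posN // => pb; apply/negbTE; rewrite -posN // -weylN //.
exact: cone_pos yW hy (in_span_cone (in_spanN hb) pb).
Qed.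

Lemma in_span_neg y b : y \in W -> (forall a, a \in A -> ~~ pos (y (val a))) ->
  in_span b -> pos (y b) = ~~ pos b.
Proof using hPi.
move=> yW hy hb; have [pb|] := boolP (pos b).
  exact/negbTE/(cone_neg hPi yW hy (in_span_cone hb pb)).
rewrite -posN // => pb.
have := cone_neg hPi yW hy (in_span_cone (in_spanN hb) pb).
by rewrite weylN // posN // negbK.
Qed.

(** For [a] in [A] the root [p a] lies in the span of [A], where [y] preserves signs. Hence a
    further left factor [srefl a] changes the lengths of [p] and of [p * y] in the same direction.
    The words in the induction need not be reduced. *)
Lemma len_par p y : y \in W -> (forall a, a \in A -> pos (y (val a))) ->
  p \in WA -> len (p * y) = (len p + len y)%N.
Proof using hPi.
move=> yW hy; move: p; apply: par_ind => [|a p aA pA IH].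
  by rewrite mul1g len1.
have pW := weyl_par_sub pA.
have := len_srefl_left hPi a (groupM pW yW); have := len_srefl_left hPi a pW.
rewrite permM (in_span_pos yW) //; last exact/in_span_par/in_span_simple.
rewrite mulgA IH; case: ifP => _ e1 e2; first by rewrite e2 e1.
by move: e2; rewrite e1 addSn => -[->].
Qed.

Lemma longest_in (C : {set {perm rootT Phi}}) x : x \in C -> longest Pi C \in C.
Proof.
move=> xC; rewrite /longest; case: arg_maxnP => //; exact: mem_repr xC.
Qed.

Lemma longest_max (C : {set {perm rootT Phi}}) x : x \in C ->
  (len x <= len (longest Pi C))%N.
Proof.
move=> xC; rewrite /longest; case: arg_maxnP => [|y _]; first exact: mem_repr xC.
exact.
Qed.

Local Notation w0 := (longest Pi WA).

Lemma w0_in : w0 \in WA. Proof. exact: longest_in (group1 _). Qed.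

Lemma par_max_neg p a : p \in WA -> len p = len w0 -> a \in A -> ~~ pos (p (val a)).
Proof using hPi.
move=> pA e aA; apply/negP => h.
have := len_srefl_left hPi a (weyl_par_sub pA); rewrite h => h'.
have := longest_max (groupM (srefl_par aA) pA).
by rewrite h' e ltnn.
Qed.

Lemma par_pos_eq1 p : p \in WA -> (forall a, a \in A -> pos (p (val a))) -> p = 1%g.
Proof using hPi.
move=> pA hp; have pW := weyl_par_sub pA; apply: (len_eq0 hPi) => //.
(* Additivity for the product of [p^-1] and [p] gives 0 as the sum of their lengths. *)
by have := len_par pW hp (groupVr pA); rewrite mulVg len1; lia.
Qed.

(** Both factors reverse signs on the span of [A], so the product keeps [A] positive and must be 1.
    Taking [p = w0] shows that [w0] is an involution, and then that it is the only such [p]. *)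
Lemma par_neg_w0V p : p \in WA -> (forall a, a \in A -> ~~ pos (p (val a))) ->
  (w0 * p = 1)%g.
Proof using hPi.
move=> pA hp; apply: par_pos_eq1 => [|a aA]; first by rewrite groupM ?w0_in.
rewrite permM (in_span_neg (weyl_par_sub pA)) //.
  exact: par_max_neg w0_in _ aA.
exact/(in_span_par w0_in)/in_span_simple.
Qed.

Lemma w0K : (w0 * w0 = 1)%g.
Proof using hPi. by apply: par_neg_w0V w0_in _ => a; apply: par_max_neg w0_in _. Qed.

Lemma par_neg_w0 p : p \in WA -> (forall a, a \in A -> ~~ pos (p (val a))) -> p = w0.
Proof using hPi. by move=> pA hp; apply: (mulgI w0); rewrite par_neg_w0V // w0K. Qed.

Lemma par_max_w0 p : p \in WA -> len p = len w0 -> p = w0.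
Proof using hPi. by move=> pA e; apply: par_neg_w0 => // a; apply: par_max_neg. Qed.

End Parabolic.

(** * Cosets of a parabolic subgroup *)

Section Cosets.
Variables (F : realFieldType) (V : vectType F) (Phi : rootSystem V).
Variables (Pi : {set rootT Phi}) (hPi : is_base Pi) (Theta : {set simple Pi}).
Implicit Types (a : simple Pi) (x y p : {perm rootT Phi}) (C D : wcoset Theta).
Local Notation W := (weyl Phi).
Local Notation WT := (weyl_par Theta).
Local Notation len := (len Pi).
Local Notation pos := (pos Pi).
Local Notation w0 := (longest Pi WT).
Local Notation top C := (longest Pi (val C)).

Definition shortest C := (w0 * top C)%g.

(** By [len_srefl_left], no left factor [srefl a] with [a] in [Theta] shortens [y]. *)
Definition left_min y := forall a, a \in Theta -> pos (y (val a)).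

Lemma coset_mem C x : x \in val C -> val C = (WT :* x)%g /\ x \in W.
Proof.
case: C => C /= /rcosetsP[z zW ->] xz; rewrite (rcoset_eqP xz); split=> //.
case/rcosetP: xz => p pW ->; rewrite groupM //; exact: weyl_par_sub pW.
Qed.

Lemma coset_inhabited C : exists x, x \in val C.
Proof. by case/rcosetsP: (valP C) => z _ ->; exists z; apply: rcoset_refl. Qed.

Lemma coset_par C x p : x \in val C -> p \in WT -> (p * x)%g \in val C.
Proof. by move=> /coset_mem[-> _] pW; apply/rcosetP; exists p. Qed.

Lemma top_in C : top C \in val C.
Proof. by have [x xC] := coset_inhabited C; apply: longest_in xC. Qed.

Lemma top_weyl C : top C \in W.
Proof. by have [] := coset_mem (top_in C). Qed.

Lemma coset_eq C D x : x \in val C -> x \in val D -> C = D.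
Proof.
move=> /coset_mem[eC _] /coset_mem[eD _].
by apply: val_inj; rewrite eC eD.
Qed.

Lemma top_inj C D : top C = top D -> C = D.
Proof. by move=> e; apply: (@coset_eq _ _ (top C)); rewrite ?top_in // e top_in. Qed.

(** Writing [top C = p * y], lengths add, so maximality forces [p] to have the length of [w0], hence
    to be [w0]. *)
Lemma top_left_min C y : y \in val C -> left_min y -> top C = (w0 * y)%g.
Proof using hPi.
move=> yC hy; have [eC yW] := coset_mem yC.
have := top_in C; rewrite eC => /rcosetP[p pW e]; rewrite e; congr (_ * _)%g.
apply: (par_max_w0 hPi pW); apply/eqP.
have := longest_max Pi (coset_par yC (w0_in Theta)); rewrite eC e.
rewrite !(len_par hPi yW hy) ?w0_in // leq_add2r => h.
by rewrite eqn_leq h longest_max.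
Qed.

Lemma left_min_exists C : exists2 y, y \in val C & left_min y.
Proof using hPi.
have [x xC] := coset_inhabited C.
have [y yC ymin] := @arg_minnP _ x (mem (val C)) len xC.
exists y => // a aT; have [_ yW] := coset_mem yC.
apply: contraT => /negPf h; have := len_srefl_left hPi a yW; rewrite h => h'.
by have := ymin _ (coset_par yC (srefl_par aT)); rewrite h' ltnn.
Qed.

Lemma shortestE C y : y \in val C -> left_min y -> shortest C = y.
Proof using hPi.
by move=> yC hy; rewrite /shortest (top_left_min yC hy) mulgA w0K // mul1g.
Qed.

Lemma shortest_in C : shortest C \in val C.
Proof using hPi. by have [y yC hy] := left_min_exists C; rewrite (shortestE yC hy). Qed.

Lemma shortest_min C : left_min (shortest C).
Proof using hPi. by have [y yC hy] := left_min_exists C; rewrite (shortestE yC hy). Qed.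

Lemma shortest_weyl C : shortest C \in W.
Proof using hPi. by have [] := coset_mem (shortest_in C). Qed.

Lemma topE C : top C = (w0 * shortest C)%g.
Proof using hPi. by rewrite /shortest mulgA w0K // mul1g. Qed.

Lemma len_coset C p : p \in WT ->
  len (p * shortest C) = (len p + len (shortest C))%N.
Proof using hPi.
by move=> pW; rewrite (len_par hPi (shortest_weyl C) (shortest_min C) pW).
Qed.

Lemma len_top C : len (top C) = (len w0 + len (shortest C))%N.
Proof using hPi. by rewrite topE len_coset // w0_in. Qed.

Lemma coset_srefl_in C a x : x \in val C -> (x * srefl a)%g \in val (coset_srefl C a).
Proof. by move=> xC; rewrite /= mem_rcoset mulgK. Qed.

Lemma coset_sreflK C a : coset_srefl (coset_srefl C a) a = C.
Proof.
apply: (@coset_eq _ _ (top C)); last exact: top_in.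
by rewrite -(mulsreflK a (top C)) !coset_srefl_in ?top_in.
Qed.

(** Deodhar's lemma. With [y = shortest C], the element [y * srefl a] is again left minimal unless
    [y] sends some root of [Theta] to [a]. If it is and the coset is unchanged, uniqueness of the
    minimal element gives [srefl a = 1], which is absurd. *)
Lemma coset_srefl_fix C a : (coset_srefl C a = C) <->
  exists2 a', a' \in Theta & shortest C (val a') = val a.
Proof using hPi.
split=> [e|[a' aT e]].
- have yC := shortest_in C; pose y := shortest C.
  have [|/existsPn h] := boolP [exists a', (a' \in Theta) && (y (val a') == val a)].
    by move=> /existsP[a' /andP[h /eqP]]; exists a'.
  have hy : left_min (y * srefl a)%g.
    move=> a' aT; rewrite permM srefl_pos ?shortest_min //.
    by have := h a'; rewrite aT.
  have := coset_srefl_in a yC; rewrite e => /shortestE/(_ hy).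
  move=> e1; have /permP/(_ (val a)) : srefl a = 1%g.
    by apply: (mulgI y); rewrite mulg1 -e1.
  by rewrite perm1 => /(congr1 pos); rewrite -/(rootN (val a)) posN // pos_simple.
- have yW := shortest_weyl C.
  apply: (@coset_eq _ _ (shortest C * srefl a)%g).
    exact: coset_srefl_in (shortest_in C).
  rewrite /srefl -e mul_refl //.
  exact: coset_par (shortest_in C) (srefl_par aT).
Qed.

Lemma shortest_fix C a : coset_srefl C a = C ->
  pos ((shortest C)^-1%g (val a)) /\ exists2 a', a' \in Theta &
    (shortest C * srefl a = srefl a' * shortest C)%g.
Proof using hPi.
move=> /coset_srefl_fix[a' aT e]; rewrite -e permK pos_simple; split=> //.
by exists a' => //; rewrite /srefl -e mul_refl ?shortest_weyl.
Qed.

Lemma shortest_srefl C a : coset_srefl C a <> C ->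
  shortest (coset_srefl C a) = (shortest C * srefl a)%g.
Proof using hPi.
move=> ne; apply: shortestE; first exact: coset_srefl_in (shortest_in C).
move=> a' aT; rewrite permM srefl_pos ?shortest_min //.
by apply/eqP => e; apply/ne/coset_srefl_fix; exists a'.
Qed.

Lemma top_srefl C a : coset_srefl C a <> C -> top (coset_srefl C a) = (top C * srefl a)%g.
Proof using hPi. by move=> ne; rewrite !topE shortest_srefl // mulgA. Qed.

Lemma coset_le_refl C : coset_le C C. Proof. exact: connect0. Qed.

Lemma coset_le_trans C D E : coset_le C D -> coset_le D E -> coset_le C E.
Proof. exact: connect_trans. Qed.

Lemma coset_lt_len C D : coset_lt C D -> (len (shortest C) < len (shortest D))%N.
Proof using hPi.
move=> /andP[ne /bruhat_len]; case=> // [||]; first exact: top_weyl.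
  by move=> /top_inj e; rewrite e eqxx in ne.
by rewrite !len_top ltn_add2l.
Qed.

Lemma coset_ltW C D : coset_lt C D -> coset_le C D. Proof. by case/andP. Qed.

Lemma coset_lt_srefl C a : coset_srefl C a <> C ->
  coset_lt C (coset_srefl C a) = (len (shortest C) < len (shortest C * srefl a))%N.
Proof using hPi.
move=> ne; rewrite -shortest_srefl //; apply/idP/idP; first exact: coset_lt_len.
move=> lt; apply/andP; split; first by apply/eqP => e; apply: ne.
rewrite /coset_le top_srefl //; apply: bruhat_srefl_gt; rewrite ?top_weyl //.
by rewrite -top_srefl // !len_top ltn_add2l.
Qed.

(** The lifting property for the longest elements; it confines [T_op a (phi (coset_srefl C a))] to
    cosets below [C]. *)
Lemma coset_le_srefl C D a : coset_lt (coset_srefl C a) C ->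
  coset_le D (coset_srefl C a) -> coset_le (coset_srefl D a) C.
Proof using hPi.
move=> lt le; have [->|/eqP ne] := eqVneq (coset_srefl D a) D.
  exact: coset_le_trans le (coset_ltW lt).
have neC : coset_srefl (coset_srefl C a) a <> coset_srefl C a.
  by rewrite coset_sreflK => e; move: lt; rewrite /coset_lt -e eqxx.
have := bruhat_srefl hPi a (top_weyl D) le.
rewrite -top_srefl // -(top_srefl neC) coset_sreflK.
by case=> // h; apply: coset_le_trans (coset_ltW lt).
Qed.

Lemma coset_cases C a : coset_srefl C a <> C ->
  coset_lt C (coset_srefl C a) \/ coset_lt (coset_srefl C a) C.
Proof using hPi.
move=> ne.
have ne' : coset_srefl (coset_srefl C a) a <> coset_srefl C a.
  by rewrite coset_sreflK => e; apply: ne.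
have -> : coset_lt (coset_srefl C a) C =
    coset_lt (coset_srefl C a) (coset_srefl (coset_srefl C a) a).
  by rewrite coset_sreflK.
rewrite !coset_lt_srefl // shortest_srefl // mulsreflK.
have := len_srefl hPi a (shortest_weyl C); case: ifP => _ ->.
  by left.
by right.
Qed.

(** The last letter of a reduced word of [shortest C] serves: it shortens that element, whereas a
    letter fixing the coset would lengthen it. *)
Lemma coset_descent C : shortest C <> 1%g -> exists a, coset_lt (coset_srefl C a) C.
Proof using hPi.
move=> ne; have [u [e su]] := weyl_word hPi (shortest_weyl C).
case/lastP: u e su => [|u a] e su; first by case: ne; rewrite e word_prod_nil.
exists a; have lt : (len (shortest C * srefl a) < len (shortest C))%N.
  by rewrite -su e size_rcons ltnS word_prod_rcons mulsreflK len_word_le.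
have neC : coset_srefl C a <> C.
  move=> h; have [h' _] := shortest_fix h.
  have := len_srefl hPi a (shortest_weyl C); rewrite h' => h''.
  by move: lt; rewrite h'' ltnNge leqnSn.
case: (coset_cases neC) => //; rewrite coset_lt_srefl // => lt'.
by move: (ltn_trans lt lt'); rewrite ltnn.
Qed.

End Cosets.

(** * Dihedral subgroups and reduced words *)

Section Dihedral.
Variables (F : realFieldType) (V : vectType F) (Phi : rootSystem V).
Variables (Pi : {set rootT Phi}) (hPi : is_base Pi).
Implicit Types (a b s t : simple Pi) (x y p : {perm rootT Phi}) (u v : seq (simple Pi)).
Local Notation W := (weyl Phi).
Local Notation len := (len Pi).
Local Notation pos := (pos Pi).

Lemma altwordS (I : Type) k (s t : I) : altword k.+1 s t = s :: altword k t s.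
Proof.
rewrite /altword /= -[1%N]/(1 + 0)%N iotaDl -map_comp; congr (_ :: _).
by apply: eq_map => j /=; case: (odd j).
Qed.

Lemma altword_rcons (I : Type) k (s t : I) :
  altword k.+1 s t = rcons (altword k s t) (if odd k then t else s).
Proof. by rewrite /altword -[k.+1]addn1 iotaD map_cat /= cats1. Qed.

Local Notation alt k s t := (word_prod (altword k s t)).

Lemma alt_par k s t : alt k s t \in weyl_par [set s; t].
Proof.
elim: k => [|k IH]; first by rewrite word_prod_nil group1.
rewrite altword_rcons word_prod_rcons groupM // srefl_par //.
by case: (odd k); rewrite !inE eqxx ?orbT.
Qed.

(** So the two alternating words of [k] letters have the same product exactly when the order of
    [srefl s * srefl t] divides [k]. *)
Lemma alt_swap k s t : alt k s t = ((srefl s * srefl t) ^+ k * alt k t s)%g.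
Proof.
have conj j : ((srefl s * srefl t) ^+ j * srefl s * (srefl s * srefl t) ^+ j = srefl s)%g.
  elim: j => [|j IH]; first by rewrite mul1g mulg1.
  rewrite {1}expgSr expgS.
  set X := (_ ^+ j)%g in IH *; rewrite !mulgA.
  by rewrite -!(mulgA _ (srefl s) (srefl s)) sreflK mulg1 mulsreflK.
elim: k => [|k IH]; first by rewrite mul1g.
rewrite !altwordS !word_prod_cons IH !mulgA; congr (_ * _)%g.
by rewrite expgSr !mulgA mulsreflK conj.
Qed.

Lemma right_neg_max s t x : x \in weyl_par [set s; t] ->
  ~~ pos (x^-1%g (val s)) -> ~~ pos (x^-1%g (val t)) ->
  x = longest Pi (weyl_par [set s; t]).
Proof using hPi.
move=> xA hs ht; rewrite -[LHS]invgK; apply/eqP.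
have -> : x^-1%g = longest Pi (weyl_par [set s; t]).
  apply: par_neg_w0; rewrite ?groupV // => a /set2P[] -> //.
by rewrite eq_invg_mul w0K.
Qed.

(** If the next letter failed to lengthen the product, both that letter and the preceding one would
    be right descents. The product would already be the longest element, against the bound on
    [k]. *)
Lemma alt_len k s t : (k <= len (longest Pi (weyl_par [set s; t])))%N ->
  len (alt k s t) = k.
Proof using hPi.
elim: k => [|k IH] hk; first by rewrite word_prod_nil len1.
have lk := IH (ltnW hk); have xA := alt_par k s t; have xW := weyl_par_sub xA.
rewrite altword_rcons word_prod_rcons; set r := if _ then _ else _.
have := len_srefl hPi r xW; case: ifP => [_ -> |/negbT hr _]; first by rewrite lk.
case: k @r => [|k] r in IH hk lk xA xW hr *.
  by move: hr; rewrite word_prod_nil invg1 perm1 pos_simple.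
pose r' := if odd k then t else s.
have hr' : ~~ pos ((alt k.+1 s t)^-1%g (val r')).
  apply/negP => h; have := len_srefl hPi r' xW; rewrite h lk.
  rewrite altword_rcons word_prod_rcons mulsreflK => e.
  by have := len_word_le (altword k s t); rewrite e size_altword; lia.
have e : alt k.+1 s t = longest Pi (weyl_par [set s; t]).
  move: hr hr'; rewrite /r /r' /=; case: (odd k) => /= hr hr';
  exact: right_neg_max.
by move: hk; rewrite -e lk ltnn.
Qed.

(** Both alternating words of [L] letters give [w0], so [m] divides [L] by [alt_swap]. If [m < L],
    the word of [m + 1] letters would be reduced; but swapping its last [m] letters creates a
    square, which cancels and leaves [m - 1] letters. *)
Lemma dihedral s t : let w0 := longest Pi (weyl_par [set s; t]) in
  [/\ len w0 = coxeter_mx s t, alt (coxeter_mx s t) s t = w0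
    & alt (coxeter_mx s t) t s = w0].
Proof using hPi.
move=> w0; set m := coxeter_mx s t; pose L := len w0.
have stC : [set t; s] = [set s; t] by rewrite setUC.
have est : alt L s t = w0.
  by apply: (par_max_w0 hPi (alt_par _ _ _)); rewrite alt_len.
have ets : alt L t s = w0.
  have := alt_par L t s; rewrite stC => h.
  by apply: (par_max_w0 hPi h); rewrite alt_len // stC.
have mL : (m %| L)%N.
  rewrite order_dvdn; have := alt_swap L s t; rewrite est ets.
  by rewrite -{1}(mul1g w0) => /mulIg <-.
have L0 : (0 < L)%N.
  have := longest_max Pi (srefl_par (set21 s t)); apply: leq_trans.
  have := len_srefl hPi s (group1 W); rewrite invg1 perm1 pos_simple mul1g => ->.
  exact: ltn0Sn.
have m0 : (0 < m)%N by apply: order_gt0.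
have sw : alt m s t = alt m t s by rewrite alt_swap expg_order mul1g.
have em : L = m.
  apply/eqP; rewrite eqn_leq (dvdn_leq L0 mL) andbT leqNgt; apply/negP => lt.
  have := alt_len lt; rewrite altwordS word_prod_cons -sw -(prednK m0) altwordS.
  rewrite word_prod_cons mulgA sreflK mul1g => e.
  by have := len_word_le (altword m.-1 t s); rewrite e size_altword; lia.
by rewrite -/m -em.
Qed.

Lemma len_par_right (A : {set simple Pi}) p y : y \in W ->
  (forall a, a \in A -> pos (y^-1%g (val a))) -> p \in weyl_par A ->
  len (y * p) = (len y + len p)%N.
Proof using hPi.
move=> yW hy pA; have pW := weyl_par_sub pA.
rewrite -(lenV hPi (groupM yW pW)) invMg (len_par hPi (groupVr yW) hy) ?groupV //.
by rewrite !lenV // addnC.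
Qed.

(** The coset decomposition of [x^-1], inverted: in [x^-1 = p * z] with [z] minimal, [z] keeps signs
    on the span of [s] and [t], so [p] makes both negative and is the longest element. *)
Lemma right_decomp s t x : x \in W ->
  ~~ pos (x^-1%g (val s)) -> ~~ pos (x^-1%g (val t)) ->
  exists y, [/\ y \in W, forall a, a \in [set s; t] -> pos (y^-1%g (val a))
              & x = (y * longest Pi (weyl_par [set s; t]))%g].
Proof using hPi.
move=> xW hs ht; set A := [set s; t].
have inr : (weyl_par A :* x^-1)%g \in rcosets (weyl_par A) (weyl Phi).
  by apply/rcosetsP; exists x^-1%g; rewrite ?groupV.
pose C : wcoset A := exist (fun D => D \in rcosets (weyl_par A) (weyl Phi)) _ inr.
have [z zC hz] := left_min_exists hPi C.
have [eC zW] := coset_mem zC.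
have : x^-1%g \in val C by apply: rcoset_refl.
rewrite eC => /rcosetP[p pA e].
exists z^-1%g; split; first by rewrite groupV.
  by move=> a aA; rewrite invgK; apply: hz.
have ep : p = longest Pi (weyl_par A).
  apply: (par_neg_w0 hPi pA) => a aA.
  rewrite -(in_span_pos hPi zW hz (in_span_par pA (in_span_simple aA))).
  by rewrite -permM -e; case/set2P: aA => ->.
rewrite -[LHS]invgK e invMg; congr (_ * _)%g; apply/eqP.
by rewrite ep eq_invg_mul w0K.
Qed.

Definition reduced u := size u = len (word_prod u).

Lemma reduced_rcons u a : reduced (rcons u a) ->
  reduced u /\ ~~ pos ((word_prod u * srefl a)^-1%g (val a)).
Proof using hPi.
rewrite /reduced size_rcons word_prod_rcons => e.
have := len_srefl hPi a (word_prod_in u); have := len_word_le u.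
have := posN hPi ((word_prod u)^-1%g (val a)).
rewrite -weylN ?groupV ?word_prod_in // invMg sreflV permM -/(rootN (val a)).
case: ifP => // _ h le h'; last by move: le; rewrite h' -e; lia.
by rewrite h; split=> //; move: h'; rewrite -e => -[].
Qed.

Lemma hecke_word_cat (m : simple Pi -> simple Pi -> nat) u v :
  hecke_word m (u ++ v) = hecke_word m u * hecke_word m v.
Proof. by rewrite /hecke_word big_cat. Qed.

Local Notation hw := (hecke_word (@coxeter_mx _ _ _ Pi)).

(* Matsumoto's theorem. If the words end in distinct letters a and b, their
   common product is y w with w the longest element of <a, b>; both words are
   compared with a reduced word of y followed by one of the two alternating words
   of w, and these differ by a braid relation. *)
Lemma hecke_word_reduced u v : reduced u -> reduced v ->
  word_prod u = word_prod v -> hw u = hw v.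
Proof using hPi.
have [n] := ubnP (size u); elim: n u v => // n IH u v lt ru rv e.
have same u' v' c : (size u' < n)%N -> reduced (rcons u' c) -> reduced (rcons v' c) ->
    word_prod (rcons u' c) = word_prod (rcons v' c) ->
    hw (rcons u' c) = hw (rcons v' c).
  move=> lt' /reduced_rcons[r1 _] /reduced_rcons[r2 _].
  rewrite !word_prod_rcons => /mulIg e'.
  by rewrite -!cats1 !hecke_word_cat (IH u' v').
have sz : size u = size v by rewrite ru rv e.
case/lastP: u => [|u a] in lt ru e sz *.
  by move/esym/size0nil: sz => ->.
case/lastP: v => [|v b] in rv e sz *; first by move: sz; rewrite size_rcons.
move: sz lt; rewrite !size_rcons => -[sz] lt.
have [_ ha] := reduced_rcons ru; have [_ hb] := reduced_rcons rv.
move: ha hb; rewrite -!word_prod_rcons -e => ha hb.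
have [y [yW hy ew]] := right_decomp (word_prod_in _) ha hb.
have [r [er sr]] := weyl_word hPi yW.
have [lw e1 e2] := dihedral a b; set m := coxeter_mx a b in lw e1 e2.
have rw f : size f = m -> word_prod f = longest Pi (weyl_par [set a; b]) ->
    reduced (r ++ f) /\ word_prod (r ++ f) = word_prod (rcons u a).
  move=> sf ef; have e' : word_prod (r ++ f) = word_prod (rcons u a).
    by rewrite word_prod_cat -er ef ew.
  split=> //; rewrite /reduced e' ew size_cat sr sf.
  by rewrite (len_par_right yW hy (w0_in _)) lw.
have [r1 w1] := rw _ (size_altword _ _ _) e1.
have [r2 w2] := rw _ (size_altword _ _ _) e2.
have br : hw (r ++ altword m a b) = hw (r ++ altword m b a).
  by rewrite !hecke_word_cat hecke_braid.
have m0 : (0 < m)%N by apply: order_gt0.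
have ltv : (size v < n)%N by rewrite -sz.
(* The parity of [m] decides which alternating word ends in [a]; the other one ends in [b]. *)
move: br r1 w1 r2 w2; rewrite -(prednK m0) !altword_rcons -!rcons_cat.
case: ifP => _ br r1 w1 r2 w2.
  rewrite (same u _ a lt ru r2) ?w2 // -br.
  by rewrite (same v _ b ltv rv r1) ?w1 // e.
rewrite (same u _ a lt ru r1) ?w1 // br.
by rewrite (same v _ b ltv rv r2) ?w2 // e.
Qed.

Lemma reduced_wordP x : x \in W ->
  reduced (reduced_word Pi x) /\ word_prod (reduced_word Pi x) = x.
Proof using hPi.
move=> /(weyl_word hPi)[u [e su]]; rewrite /reduced_word; case: pickP => [v /eqP ev|].
  by split=> //; rewrite /reduced ev size_tuple.
by move=> /(_ (tcast su (in_tuple u))); rewrite val_tcast /= e eqxx.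
Qed.

Lemma hecke_basis_word u : reduced u -> hecke_basis Pi (word_prod u) = hw u.
Proof using hPi.
move=> ru; have [r1 e] := reduced_wordP (word_prod_in u).
exact: hecke_word_reduced.
Qed.

Lemma hecke_basis1 : hecke_basis Pi 1 = 1.
Proof using hPi.
rewrite -(word_prod_nil Pi) hecke_basis_word; first by rewrite /hecke_word big_nil.
by rewrite /reduced word_prod_nil len1.
Qed.

Lemma hecke_basis_gt x a : x \in W -> pos (x^-1%g (val a)) ->
  hecke_basis Pi (x * srefl a) = hecke_basis Pi x * hecke_gen _ a.
Proof using hPi.
move=> xW h; have [u [e su]] := weyl_word hPi xW.
have := len_srefl hPi a xW; rewrite h => l.
rewrite e -word_prod_rcons !hecke_basis_word /reduced ?size_rcons ?su -?e //.
  by rewrite -cats1 hecke_word_cat /hecke_word big_seq1.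
by rewrite word_prod_rcons -e l.
Qed.

Lemma hecke_basis_gt_left x a : x \in W -> pos (x (val a)) ->
  hecke_basis Pi (srefl a * x) = hecke_gen _ a * hecke_basis Pi x.
Proof using hPi.
move=> xW h; have [u [e su]] := weyl_word hPi xW.
have := len_srefl_left hPi a xW; rewrite h => l.
rewrite e -word_prod_cons !hecke_basis_word /reduced /= ?su -?e //.
  by rewrite /hecke_word big_cons.
by rewrite word_prod_cons -e l.
Qed.

End Dihedral.

(** * The antispherical module *)

Section RightAction.
Variables (I : finType) (m : I -> I -> nat) (Theta : {set I}).
Local Notation N := (antispherical m Theta).
Implicit Types (x y : N) (g h : hecke m).

Lemma tens_ind (P : N -> Prop) : P 0 -> (forall x, P x -> P (- x)) ->
  (forall x y, P x -> P y -> P (x + y)) -> (forall a h, P (tens Theta a h)) ->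
  forall x, P x.
Proof.
move=> P0 PN PD Pt; elim/tclassW; elim=> [a h||x|x hx y hy].
- exact: Pt.
- exact: P0.
- by rewrite tclassNE; apply: PN.
- by rewrite tclassDE; apply: PD.
Qed.

Definition rmul g x : N := tterm_map Theta id ( *%R^~ g) (repr x).

Lemma rmul_tclass g t : rmul g (tclass Theta t) = tterm_map Theta id ( *%R^~ g) t.
Proof.
apply: tterm_map_rel (tclass_reprP Theta t) => //.
- by move=> h k; rewrite mulrDl.
- by move=> a k h hk; rewrite tens_balanced // mulrA.
Qed.

Lemma rmul_tens g a h : rmul g (tens Theta a h) = tens Theta a (h * g).
Proof. exact: rmul_tclass. Qed.

Fact rmul_is_zmod_morphism g : zmod_morphism (rmul g).
Proof.
by elim/tclassW=> x; elim/tclassW=> y; rewrite -tclassNE -tclassDE !rmul_tclass.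
Qed.

HB.instance Definition _ g := GRing.isZmodMorphism.Build N N (rmul g)
  (rmul_is_zmod_morphism g).

Lemma rmulZ g c x : rmul g (c *: x) = c *: rmul g x.
Proof.
elim/tens_ind: x => [|x hx|x y hx hy|a h].
- by rewrite scaler0 raddf0 scaler0.
- by rewrite scalerN !raddfN /= hx.
- by rewrite scalerDr !raddfD /= hx hy.
- by rewrite scale_tens !rmul_tens scale_tens.
Qed.

Lemma rmul_bar g x :
  antispherical_bar (rmul g x) = rmul (hecke_bar g) (antispherical_bar x).
Proof.
elim/tens_ind: x => [|x hx|x y hx hy|a h].
- by rewrite !raddf0.
- by rewrite !raddfN /= hx.
- by rewrite !raddfD /= hx hy.
- by rewrite rmul_tens !antispherical_bar_tens rmul_tens rmorphM.
Qed.

Lemma antispherical_barZ c x :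
  antispherical_bar (c *: x) = lbar c *: antispherical_bar x.
Proof.
elim/tens_ind: x => [|x hx|x y hx hy|a h].
- by rewrite scaler0 raddf0 scaler0.
- by rewrite scalerN !raddfN /= hx.
- by rewrite scalerDr !raddfD /= hx hy.
- by rewrite scale_tens !antispherical_bar_tens scale_tens rmorphM.
Qed.

Lemma tens_scale_right c a h : tens Theta a (c *: h) = c *: tens Theta a h.
Proof.
by rewrite -mulr_algl -tens_balanced ?hecke_sgnS ?scale_tens 1?mulrC //; apply: hpar_scal.
Qed.

Lemma hecke_gen_bar s : hecke_bar (hecke_gen m s + lq%:A) = hecke_gen m s + lq%:A.
Proof.
rewrite rmorphD /= hecke_bar_gen hecke_barZ rmorph1 lbarq /hecke_genV -addrA.
by rewrite -scalerDl subrK.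
Qed.

Lemma hecke_gen_quadratic s :
  hecke_gen m s * (hecke_gen m s + lq%:A) = 1 + lqV *: hecke_gen m s.
Proof.
rewrite -[in RHS](hecke_genK m s) /hecke_genV -(mulr_algr _ (hecke_gen m s)).
by rewrite -mulrDr -addrA -scalerDl subrK.
Qed.

End RightAction.

(** * The coset module and the operators T_alpha inside the antispherical module *)

Section CosetIso.
Variables (F : realFieldType) (V : vectType F) (Phi : rootSystem V).
Variables (Pi : {set rootT Phi}) (hPi : is_base Pi) (Theta : {set simple Pi}).
Implicit Types (a : simple Pi) (C D : wcoset Theta) (E : coset_module Theta).
Local Notation mx := (@coxeter_mx _ _ _ Pi).
Local Notation N := (antispherical mx Theta).
Local Notation iso := (@coset_iso _ _ _ _ Theta).

Definition tbasis C : N := tens Theta 1 (hecke_basis Pi (shortest C)).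

Lemma coset_isoE E : coset_iso E = \sum_C (E C : laurent) *: tbasis C.
Proof. by []. Qed.

Fact coset_iso_is_linear : linear iso.
Proof.
move=> c E E'; rewrite !coset_isoE scaler_sumr -big_split; apply: eq_bigr => C _.
by rewrite !ffunE scalerDl scalerA.
Qed.

HB.instance Definition _ := GRing.isLinear.Build laurent (coset_module Theta) N
  *:%R iso coset_iso_is_linear.

Lemma coset_iso_delta C : coset_iso (delta C) = tbasis C.
Proof.
rewrite coset_isoE (bigD1 C) //= ffunE eqxx scale1r big1 ?addr0 // => D /negPf ne.
by rewrite ffunE ne scale0r.
Qed.

Lemma coset_iso_delta2 c C D :
  coset_iso (c *: delta C + delta D) = c *: tbasis C + tbasis D.
Proof. by rewrite -!coset_iso_delta; apply: coset_iso_is_linear. Qed.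

(** If the coset is fixed, [y * srefl a = srefl a' * y] with [a'] in [Theta]; then [H_a'] crosses
    the tensor sign as -q and cancels the summand q. An ascent is [H_y H_a = H_(y s)], and a descent
    uses [H_a (H_a + q) = 1 + q^-1 H_a]. *)
Lemma coset_iso_T_delta a C :
  coset_iso (T_delta a C) = rmul (hecke_gen mx a + lq%:A) (tbasis C).
Proof using hPi.
rewrite /T_delta /tbasis rmul_tens; set y := shortest C.
have yW : y \in weyl Phi := shortest_weyl hPi C.
have [e|/eqP ne] := eqVneq (coset_srefl C a) C.
  have [h [a' aT ya]] := shortest_fix hPi e; rewrite -/y in h ya.
  rewrite raddf0 mulrDr tensDr mulr_algr tens_scale_right -hecke_basis_gt // ya.
  rewrite (hecke_basis_gt_left hPi yW); last exact: (shortest_min hPi C aT).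
  rewrite -tens_balanced; last exact: hpar_gen.
  rewrite hecke_sgn_gen mul1r scale_tens mulr1 -tensDl addNr.
  by rewrite -(mul0r 1) -scale_tens scale0r.
have ys := shortest_srefl hPi ne; rewrite -/y in ys.
rewrite coset_lt_srefl // -/y.
have := len_srefl hPi a yW; case: ifP => h e.
  rewrite e ltnSn coset_iso_delta2 /tbasis ys hecke_basis_gt //.
  by rewrite mulrDr mulr_algr tensDr tens_scale_right addrC.
rewrite {1}e ltnNge leqnSn coset_iso_delta2 /tbasis ys.
have h' : pos Pi ((y * srefl a)^-1%g (val a)).
  by rewrite invMg sreflV permM -/(rootN (val a)) weylN ?groupV // posN // h.
have ey : hecke_basis Pi y = hecke_basis Pi (y * srefl a)%g * hecke_gen mx a.
  by rewrite -(hecke_basis_gt hPi _ h') ?mulsreflK // groupM ?srefl_in.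
rewrite -/y ey -mulrA hecke_gen_quadratic mulrDr mulr1 -scalerAr tensDr.
by rewrite tens_scale_right addrC.
Qed.

Lemma coset_iso_T a E :
  coset_iso (T_op a E) = rmul (hecke_gen mx a + lq%:A) (coset_iso E).
Proof using hPi.
rewrite /T_op linear_sum coset_isoE raddf_sum; apply: eq_bigr => C _.
by rewrite linearZ /= rmulZ coset_iso_T_delta.
Qed.

Lemma T_self_dual a E : self_dual E -> self_dual (T_op a E).
Proof using hPi. by rewrite /self_dual coset_iso_T rmul_bar hecke_gen_bar => ->. Qed.

End CosetIso.

(** * The regular module *)

Lemma laurent_scaleE (k z : laurent) : k *: (z : laurent^o) = k * z.
Proof. by []. Qed.

Section RegularModule.
Variables (F : realFieldType) (V : vectType F) (Phi : rootSystem V).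
Variables (Pi : {set rootT Phi}) (hPi : is_base Pi).
Implicit Types (a s t : simple Pi) (x y p : {perm rootT Phi}) (u v : seq (simple Pi)).
Local Notation W := (weyl Phi).
Local Notation len := (len Pi).
Local Notation pos := (pos Pi).
Local Notation mx := (@coxeter_mx _ _ _ Pi).

Definition regular := {ffun {perm rootT Phi} -> laurent^o}.
Implicit Types (f g : regular).

(* Right multiplication by H_s on the functions on W. The permutations outside
   W play no role: there H_s acts by its character -q, so that the Hecke
   relations hold on all functions. *)
Definition reg_gen s f : regular := [ffun x =>
  if x \in W then (f (x * srefl s)%g : laurent) +
      (if pos (x^-1%g (val s)) then 0 else (lqV - lq) * f x)
  else - lq * f x].

Fact reg_gen_is_linear s : linear (reg_gen s).
Proof.
move=> c f g; apply/ffunP => x; rewrite !ffunE.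
case: ifP => _; last by rewrite !laurent_scaleE; ring.
by case: ifP => _; rewrite !laurent_scaleE; ring.
Qed.

HB.instance Definition _ s := GRing.isLinear.Build laurent regular regular
  *:%R (reg_gen s) (reg_gen_is_linear s).

Lemma pos_srefl_inv x s : x \in W ->
  pos ((x * srefl s)^-1%g (val s)) = ~~ pos (x^-1%g (val s)).
Proof using hPi.
by move=> xW; rewrite invMg sreflV permM -/(rootN (val s)) weylN ?groupV // posN.
Qed.

Lemma reg_gen_quadratic s f :
  reg_gen s (reg_gen s f) = f + (lqV - lq) *: reg_gen s f.
Proof using hPi.
apply/ffunP => x; rewrite !ffunE.
rewrite laurent_scaleE; case: ifP => xW; last first.
  by rewrite xW -[X in _ = X + _](@mul1r laurent) -lqVq; ring.
rewrite xW groupM ?srefl_in // pos_srefl_inv // mulsreflK.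
by case: (pos _) => /=; ring.
Qed.

Definition reg_word u f := foldl (fun f s => reg_gen s f) f u.

Lemma reg_word_rcons u s f : reg_word (rcons u s) f = reg_gen s (reg_word u f).
Proof. by rewrite /reg_word -cats1 foldl_cat. Qed.

Fact reg_word_is_linear u : linear (reg_word u).
Proof.
move=> c f g; elim/last_ind: u => [|u s IH] //.
by rewrite !reg_word_rcons IH linearP.
Qed.

HB.instance Definition _ u := GRing.isLinear.Build laurent regular regular
  *:%R (reg_word u) (reg_word_is_linear u).

(** The quadratic relation applies to the repeated first letter on the left and, after using the
    hypothesis, to a repeated last letter on the right. This carries the braid relation from
    [x * srefl s] up to [x]. *)
Lemma reg_braid_stable k s t f :
  reg_word (altword k.+1 s t) f = reg_word (altword k.+1 t s) f ->
  reg_word (altword k.+1 s t) (reg_gen s f) = reg_word (altword k.+1 t s) (reg_gen s f).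
Proof using hPi.
move=> e; pose r := if odd k then s else t.
have -> : reg_word (altword k.+1 t s) (reg_gen s f) =
    reg_gen r (reg_word (altword k.+1 t s) f).
  rewrite -[LHS]/(reg_word (s :: altword k.+1 t s) f) -altwordS altword_rcons.
  by rewrite reg_word_rcons e /= if_neg.
have er : reg_word (altword k.+1 t s) f = reg_gen r (reg_word (altword k t s) f).
  by rewrite altword_rcons reg_word_rcons.
rewrite {1}er reg_gen_quadratic -er -e !altwordS.
rewrite -[LHS]/(reg_word (altword k t s) (reg_gen s (reg_gen s f))).
by rewrite reg_gen_quadratic linearD linearZ.
Qed.

Definition reg_delta x : regular := [ffun y => (y == x)%:R].

Lemma reg_gen_delta x s : x \in W -> pos (x^-1%g (val s)) ->
  reg_gen s (reg_delta x) = reg_delta (x * srefl s)%g.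
Proof.
move=> xW h; apply/ffunP => y; rewrite !ffunE.
have e : (y * srefl s == x)%g = (y == x * srefl s)%g.
  by apply/eqP/eqP => [<-|->]; rewrite mulsreflK.
case: ifP => yW.
  rewrite e; case: ifP => h'; rewrite ?addr0 //.
  have [yx|_] := eqVneq y x; last by rewrite mulr0 addr0.
  by rewrite yx h in h'.
have [ey|_] := eqVneq y x; first by rewrite ey xW in yW.
have [ey|_] := eqVneq y (x * srefl s)%g; last by rewrite mulr0.
by rewrite ey groupM ?srefl_in in yW.
Qed.

Lemma reg_sum f : f = \sum_x (f x : laurent) *: reg_delta x.
Proof.
apply/ffunP => y; rewrite sum_ffunE (bigD1 y) //= big1 => [|x /negPf ne].
  by rewrite !ffunE eqxx addr0 /GRing.scale /= mulr1.
by rewrite !ffunE eq_sym ne scaler0.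
Qed.

Lemma reg_word_out x u : x \notin W ->
  reg_word u (reg_delta x) = (- lq) ^+ size u *: reg_delta x.
Proof.
move=> xW; elim/last_ind: u => [|u s IH]; first by rewrite scale1r.
rewrite reg_word_rcons IH linearZ size_rcons exprSr -scalerA; congr (_ *: _).
apply/ffunP => y; rewrite !ffunE; case: ifP => // yW.
have [ey|_] := eqVneq y x; first by rewrite ey (negPf xW) in yW.
have [ey|_] := eqVneq (y * srefl s)%g x.
  by move: xW; rewrite -ey groupM ?srefl_in.
by rewrite mulr0 scaler0 add0r; case: ifP.
Qed.

Lemma reg_word_alt s t k x : x \in W -> (k <= coxeter_mx s t)%N ->
  pos (x^-1%g (val s)) -> pos (x^-1%g (val t)) ->
  reg_word (altword k s t) (reg_delta x) = reg_delta (x * word_prod (altword k s t))%g.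
Proof using hPi.
move=> xW km hs ht; have [lw _ _] := dihedral hPi s t.
have hx a : a \in [set s; t] -> pos (x^-1%g (val a)) by case/set2P=> ->.
elim: k km => [|k IH] km; first by rewrite word_prod_nil mulg1.
rewrite altword_rcons reg_word_rcons IH ?(ltnW km) //.
have pA := alt_par k s t; have xpW := groupM xW (weyl_par_sub pA).
rewrite reg_gen_delta //; first by rewrite word_prod_rcons mulgA.
apply: contraT => /negPf h; have := len_srefl hPi (if odd k then t else s) xpW.
rewrite h -mulgA -word_prod_rcons -altword_rcons.
rewrite !(len_par_right hPi xW hx) ?alt_par // !alt_len ?lw ?(ltnW km) //.
by rewrite addnS => /eqP; rewrite ltn_eqF // ltnS leqnSn.
Qed.

(** By linearity it is enough to treat [reg_delta x]. For [x] in [W] with a right descent among [s]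
    and [t], [reg_braid_stable] reduces to a shorter element. Without one, both words act by right
    translation, by the same longest element. *)
Lemma reg_braid s t f : reg_word (altword (coxeter_mx s t) s t) f =
  reg_word (altword (coxeter_mx s t) t s) f.
Proof using hPi.
have [_ e1 e2] := dihedral hPi s t; set m := coxeter_mx s t in e1 e2 *.
have m0 : (0 < m)%N by apply: order_gt0.
rewrite (reg_sum f) !linear_sum; apply: eq_bigr => x _.
rewrite !linearZ /=; congr (_ *: _).
have [xW|xW] := boolP (x \in W); last by rewrite !reg_word_out // !size_altword.
have [n] := ubnP (len x); elim: n x xW => // n IH x xW lt.
have down r : ~~ pos (x^-1%g (val r)) -> [/\ (x * srefl r)%g \in W,
    (len (x * srefl r) < n)%N & reg_delta x = reg_gen r (reg_delta (x * srefl r)%g)].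
  move=> h; have xrW := groupM xW (srefl_in r); split=> //.
    by move: lt; have := len_srefl hPi r xW; rewrite (negPf h) => ->.
  by rewrite reg_gen_delta ?mulsreflK ?pos_srefl_inv.
have [hs|/down[xrW ltr ->]] := boolP (pos (x^-1%g (val s))); last first.
  by have := IH _ xrW ltr; rewrite -(prednK m0); apply: reg_braid_stable.
have [ht|/down[xrW ltr ->]] := boolP (pos (x^-1%g (val t))); last first.
  have := IH _ xrW ltr; rewrite -(prednK m0) => /esym e.
  exact/esym/reg_braid_stable.
have mC : coxeter_mx t s = coxeter_mx s t.
  have [<- _ _] := dihedral hPi t s; have [<- _ _] := dihedral hPi s t.
  by rewrite setUC.
by rewrite !reg_word_alt -/m ?mC // e1 e2.
Qed.

Fixpoint reg_act (h : hterm (simple Pi)) f : regular :=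
  match h with
  | HGen s => reg_gen s f
  | HScal c => c *: f
  | HAdd h k => reg_act h f + reg_act k f
  | HMul h k => reg_act k (reg_act h f)
  end.

Fact reg_act_is_linear h : linear (reg_act h).
Proof.
elim: h => [s|c'|h IHh k IHk|h IHh k IHk] c f g /=; first exact: linearP.
- by rewrite scalerDr !scalerA mulrC.
- by rewrite IHh IHk scalerDr addrACA.
- by rewrite IHh IHk.
Qed.

HB.instance Definition _ h := GRing.isLinear.Build laurent regular regular
  *:%R (reg_act h) (reg_act_is_linear h).

Lemma reg_act_word u f : reg_act (hword u) f = reg_word u f.
Proof. by elim: u f => [|s u IH] f /=; [rewrite scale1r | rewrite IH]. Qed.

Lemma reg_act_rel h k : hrel mx h k -> forall f, reg_act h f = reg_act k f.
Proof using hPi.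
elim=> {h k}.
- by [].
- by move=> h k _ IH f; rewrite IH.
- by move=> h k l _ IH1 _ IH2 f; rewrite IH1 IH2.
- by move=> h h' k k' _ IH1 _ IH2 f /=; rewrite IH1 IH2.
- by move=> h h' k k' _ IH1 _ IH2 f /=; rewrite IH1 IH2.
- by move=> h k l f /=; rewrite addrA.
- by move=> h k f /=; rewrite addrC.
- by move=> h f /=; rewrite scale0r add0r.
- by [].
- by move=> h f /=; rewrite scale1r.
- by move=> h f /=; rewrite !scale0r linear0.
- by move=> h k l f /=; rewrite linearD.
- by [].
- by move=> a b f /=; rewrite scalerDl.
- by move=> a b f /=; rewrite scalerA mulrC.
- by move=> c h f /=; rewrite linearZ.
- move=> s f /=; rewrite linearD linearZ /= reg_gen_quadratic scale0r.
  rewrite scalerDr scalerA mulNr lqVq scaleN1r !scalerBl !scaleNr.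
  apply/ffunP => x; rewrite !ffunE; set a := f x.
  set b := reg_gen s f x; rewrite /GRing.scale /=; ring.
- by move=> s t f; rewrite !reg_act_word reg_braid.
Qed.

Definition reg_mul (h : hecke mx) f : regular := reg_act (repr h) f.

Lemma reg_mul_class h f : reg_mul (hclass mx h) f = reg_act h f.
Proof using hPi. exact/reg_act_rel/hclass_reprP. Qed.

Lemma reg_mulD (h k : hecke mx) f : reg_mul (h + k) f = reg_mul h f + reg_mul k f.
Proof using hPi.
by elim/heckeW: h => h; elim/heckeW: k => k; rewrite -hclassDE !reg_mul_class.
Qed.

Lemma reg_mulM (h k : hecke mx) f : reg_mul (h * k) f = reg_mul k (reg_mul h f).
Proof using hPi.
by elim/heckeW: h => h; elim/heckeW: k => k; rewrite -hclassME !reg_mul_class.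
Qed.

Lemma reg_mulS c f : reg_mul (c%:A) f = c *: f.
Proof using hPi. by rewrite -hclassS reg_mul_class. Qed.

Lemma reg_mul_gen s f : reg_mul (hecke_gen mx s) f = reg_gen s f.
Proof using hPi. exact: reg_mul_class. Qed.

Lemma reg_mulZ (h : hecke mx) c f : reg_mul h (c *: f) = c *: reg_mul h f.
Proof. by rewrite /reg_mul linearZ. Qed.

End RegularModule.

(** * Linear independence in the antispherical module *)

Section Independence.
Variables (F : realFieldType) (V : vectType F) (Phi : rootSystem V).
Variables (Pi : {set rootT Phi}) (hPi : is_base Pi) (Theta : {set simple Pi}).
Implicit Types (a s : simple Pi) (x y p : {perm rootT Phi}) (C D : wcoset Theta).
Local Notation W := (weyl Phi).
Local Notation WT := (weyl_par Theta).
Local Notation len := (len Pi).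
Local Notation pos := (pos Pi).
Local Notation mx := (@coxeter_mx _ _ _ Pi).
Local Notation N := (antispherical mx Theta).

Definition antisym : regular Phi :=
  [ffun x => if x \in WT then (- lq) ^+ len x else 0].

(** The values at [x] and [x * srefl s] differ by a factor -q. This eigenvector property is what
    makes [tens_eval] respect the balancing relation. *)
Lemma reg_gen_antisym s : s \in Theta -> reg_gen s antisym = - lq *: antisym.
Proof using hPi.
move=> sT; apply/ffunP => x; rewrite !ffunE /GRing.scale /=.
case: ifP => // xW; rewrite groupMr ?srefl_par //.
case: ifP => xT; last by rewrite !mulr0 if_same addr0.
have := len_srefl hPi s xW; case: ifP => _ ->; first by rewrite addr0 exprS.
set z := (- lq) ^+ _; rewrite exprS -/z -[X in X + _](@mul1r laurent) -lqVq; ring.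
Qed.

Lemma reg_mul_antisym (g : hecke mx) : hecke_parabolic Theta g ->
  reg_mul g antisym = hecke_sgn g *: antisym.
Proof using hPi.
elim=> {g} [s sT|c|g h _ IHg _ IHh|g h _ IHg _ IHh].
- by rewrite reg_mul_gen // reg_gen_antisym // hecke_sgn_gen.
- by rewrite reg_mulS // hecke_sgnS.
- by rewrite reg_mulD // IHg IHh hecke_sgnD scalerDl.
- by rewrite reg_mulM // IHg reg_mulZ IHh hecke_sgnM scalerA.
Qed.

Fixpoint tens_eval (t : tterm mx) : regular Phi :=
  match t with
  | TPure a h => a *: reg_mul h antisym
  | TZero => 0
  | TOpp t => - tens_eval t
  | TAdd t t' => tens_eval t + tens_eval t'
  end.

Lemma tens_eval_rel t t' : trel Theta t t' -> tens_eval t = tens_eval t'.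
Proof using hPi.
elim=> //= {t t'}.
- by move=> x y z _ -> _ ->.
- by move=> x x' _ ->.
- by move=> x x' y y' _ -> _ ->.
- by move=> x y z; rewrite addrA.
- by move=> x y; rewrite addrC.
- by move=> x; rewrite add0r.
- by move=> x; rewrite addNr.
- by move=> a b h; rewrite scalerDl.
- by move=> a h g; rewrite reg_mulD // scalerDr.
- by move=> a g h hg; rewrite reg_mulM // (reg_mul_antisym hg) reg_mulZ scalerA.
Qed.

(* The map a (x) h |-> a (e h), where e is the sum of the (-q)^(len p) H_p over
   the p in W_Theta. *)
Definition antisymmetrize (n : N) : regular Phi := tens_eval (repr n).

Lemma antisymmetrize_class t : antisymmetrize (tclass Theta t) = tens_eval t.
Proof using hPi. exact/tens_eval_rel/tclass_reprP. Qed.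

Lemma antisymmetrizeD n n' :
  antisymmetrize (n + n') = antisymmetrize n + antisymmetrize n'.
Proof using hPi.
by elim/tclassW: n => n; elim/tclassW: n' => n'; rewrite -tclassDE !antisymmetrize_class.
Qed.

Lemma antisymmetrize0 : antisymmetrize 0 = 0.
Proof using hPi. exact: antisymmetrize_class. Qed.

Lemma antisymmetrizeN n : antisymmetrize (- n) = - antisymmetrize n.
Proof using hPi. by elim/tclassW: n => n; rewrite -tclassNE !antisymmetrize_class. Qed.

Lemma antisymmetrize_tens c h : antisymmetrize (tens Theta c h) = c *: reg_mul h antisym.
Proof using hPi. exact: antisymmetrize_class. Qed.

Lemma antisymmetrizeZ c n : antisymmetrize (c *: n) = c *: antisymmetrize n.
Proof using hPi.
elim/tens_ind: n => [|x hx|x y hx hy|a h].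
- by rewrite scaler0 antisymmetrize0 scaler0.
- by rewrite scalerN !antisymmetrizeN hx scalerN.
- by rewrite scalerDr !antisymmetrizeD hx hy scalerDr.
- by rewrite scale_tens !antisymmetrize_tens scalerA.
Qed.

(** In other words [e H_y] is the sum of the [(-q)^(len p) H_(p * y)], with [y = shortest C]. The
    induction goes from [D] to [C] along a descent: right translation by [srefl a] moves the support
    from [D] to [C] and raises every length by one. *)
Lemma antisymmetrize_tbasis C : antisymmetrize (tbasis C) =
  [ffun x => if x \in val C then (- lq) ^+ (len x - len (shortest C)) else 0].
Proof using hPi.
rewrite /tbasis antisymmetrize_tens scale1r.
have [n] := ubnP (len (shortest C)); elim: n C => // n IH C lt.
have [e|/eqP ne] := eqVneq (shortest C) 1%g.
  have CE : val C = WT.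
    by have [-> _] := coset_mem (shortest_in hPi C); rewrite e mulg1.
  rewrite e hecke_basis1 // -[1]scale1r reg_mulS // scale1r.
  by apply/ffunP => x; rewrite !ffunE CE len1 subn0.
have [a aC] := coset_descent hPi ne; set D := coset_srefl C a in aC.
have DC : D <> C by move=> h; move: aC; rewrite h /coset_lt eqxx.
have CE : coset_srefl D a = C by rewrite coset_sreflK.
have neD : coset_srefl D a <> D by rewrite CE => h; apply: DC.
have yC := shortest_srefl hPi neD; rewrite CE in yC.
have ltD := coset_lt_len hPi aC.
have hpos : pos ((shortest D)^-1%g (val a)).
  apply: contraT => /negPf h; have := len_srefl hPi a (shortest_weyl hPi D).
  by rewrite h -yC => h'; move: ltD; rewrite h' ltnNge leqnSn.
have lC : len (shortest C) = (len (shortest D)).+1.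
  by have := len_srefl hPi a (shortest_weyl hPi D); rewrite hpos -yC.
rewrite yC hecke_basis_gt ?shortest_weyl // reg_mulM // reg_mul_gen //.
rewrite IH; last exact: leq_trans ltD lt.
apply/ffunP => x; rewrite !ffunE -yC.
have xD : ((x * srefl a)%g \in val D) = (x \in val C).
  apply/idP/idP => [/(coset_srefl_in a)|]; last exact: coset_srefl_in.
  by rewrite mulsreflK CE.
case: ifP => xW; last first.
  have [/coset_mem[_]|_] := boolP (x \in val D); first by rewrite xW.
  rewrite mulr0; have [/coset_mem[_]|//] := boolP (x \in val C); by rewrite xW.
rewrite xD; have [xC|xC] := boolP (x \in val C).
  have [xD'|_] := boolP (x \in val D); first by case: DC; apply: coset_eq xD' xC.
  rewrite mulr0 if_same addr0; congr (_ ^+ _).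
  have [eC _] := coset_mem (shortest_in hPi C).
  move: xC; rewrite eC => /rcosetP[p pT ->].
  by rewrite len_coset // {1}yC mulgA mulsreflK len_coset // !addnK.
have [xD'|_] := boolP (x \in val D); last by rewrite mulr0 if_same addr0.
have [eD _] := coset_mem (shortest_in hPi D).
move: xD'; rewrite eD => /rcosetP[p pT xp].
(* A point of [D] is lengthened by [srefl a], so the term with [lqV - lq] does not occur there. *)
have := len_srefl hPi a xW; case: ifP => _; first by rewrite addr0.
rewrite xp -mulgA -yC !len_coset // lC => /eqP.
by rewrite !addnS ltn_eqF // ltnS leqnSn.
Qed.

Lemma tbasis_free (c : wcoset Theta -> laurent) :
  \sum_C c C *: tbasis C = 0 -> forall C, c C = 0.
Proof using hPi.
move=> e C; have := congr1 antisymmetrize e; rewrite antisymmetrize0.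
rewrite (big_morph _ antisymmetrizeD antisymmetrize0).
move=> /ffunP/(_ (shortest C)); rewrite sum_ffunE ffunE (bigD1 C) //= big1.
  rewrite addr0 antisymmetrizeZ antisymmetrize_tbasis !ffunE shortest_in //.
  by rewrite subnn /GRing.scale /= mulr1.
move=> D ne; rewrite antisymmetrizeZ antisymmetrize_tbasis !ffunE.
case: ifP => [h|_]; last by rewrite scaler0.
by case/eqP: ne; apply: coset_eq h (shortest_in hPi C).
Qed.

Lemma coset_iso_eq0 (E : coset_module Theta) : coset_iso E = 0 -> E = 0.
Proof using hPi.
by move=> /tbasis_free e; apply/ffunP => C; rewrite ffunE e.
Qed.

End Independence.

(** * Self-dual elements *)

(** Multiplying p(q) = p(q^-1) by q^n, with n the size of p, gives a polynomial identity whose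
    right-hand side [r] has degree at most n. Hence p has no coefficient in positive degree. *)
Lemma lbar_fixed_int (p : {poly int}) :
  lbar (laurent_poly p) = laurent_poly p -> exists z : int, laurent_poly p = z%:~R.
Proof.
have h0 : laurent_poly p * lq ^+ 0 = laurent_poly p by rewrite expr0 mulr1.
rewrite (lbarE h0) expr0 mulr1 => e; pose n := size p.
pose r : {poly int} := \sum_(i < n) p`_i *: 'X^(n - i).
have eq_r : 'X^n * p = r.
  apply: laurent_poly_inj; rewrite rmorphM rmorphXn /= -e /r rmorph_sum /= /eval_lqV.
  rewrite (@horner_coef_wide _ n) ?size_poly // mulr_sumr; apply: eq_bigr => i _.
  rewrite coef_map_id0 // -mul_polyC rmorphM rmorphXn /= mulrCA -/lq; congr (_ * _).
    by rewrite -[in RHS](intz p`_i) !rmorph_int.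
  rewrite -{1}(subnK (ltnW (ltn_ord i))) exprD -mulrA -exprMn lqqV expr1n mulr1 //.
have pj j : (0 < j)%N -> p`_j = 0.
  move=> j0; have := congr1 (fun s : {poly int} => s`_(n + j)) eq_r.
  rewrite /= coefXnM ltnNge leq_addr /= addKn => ->.
  rewrite coef_sum big1 // => i _; rewrite coefZ coefXn.
  by rewrite gtn_eqF ?mulr0 //; apply: leq_ltn_trans (leq_subr i n) _; lia.
exists p`_0; suff {1}-> : p = (p`_0)%:P by rewrite -{1}(intz p`_0) !rmorph_int.
apply/polyP => [[|j]]; rewrite coefC //=; exact: pj.
Qed.

(** * Unitriangular families and the two implications *)

Section KazhdanLusztig.
Variables (F : realFieldType) (V : vectType F) (Phi : rootSystem V).
Variables (Pi : {set rootT Phi}) (hPi : is_base Pi) (Theta : {set simple Pi}).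
Variable phi : wcoset Theta -> coset_module Theta.
Hypothesis hphi : forall C : wcoset Theta, exists P : wcoset Theta -> laurent,
   (forall D, coset_lt D C -> in_qZq (P D)) /\
   phi C = delta C + \sum_(D | coset_lt D C) P D *: delta D.
Implicit Types (a : simple Pi) (C D : wcoset Theta) (E : coset_module Theta).
Local Notation len := (len Pi).

Lemma scale_coef c E D : (c *: E) D = c * (E D : laurent).
Proof. by rewrite ffunE. Qed.

Lemma delta_coef C D : delta C D = (D == C)%:R :> laurent.
Proof. by rewrite ffunE. Qed.

Lemma phi_coefs C : exists P : wcoset Theta -> laurent,
  (forall D, coset_lt D C -> in_qZq (P D)) /\
  forall D, phi C D = (D == C)%:R + \sum_(D' | coset_lt D' C) P D' * (D == D')%:R
    :> laurent.
Proof using hphi.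
have [P [hP ->]] := hphi C; exists P; split=> // D.
rewrite ffunE delta_coef sum_ffunE; congr (_ + _).
by apply: eq_bigr => D' _; rewrite scale_coef delta_coef.
Qed.

Lemma phi_diag C : phi C C = 1.
Proof using hphi.
have [P [_ ->]] := phi_coefs C; rewrite eqxx big1 ?addr0 // => D lt.
case: eqP => [e|_]; last by rewrite mulr0.
by move: lt; rewrite -e /coset_lt eqxx.
Qed.

Lemma phi_supp C D : phi C D != 0 -> D != C ->
  coset_lt D C /\ exists p, phi C D = laurent_poly ('X * p).
Proof using hphi.
have [P [hP ->]] := phi_coefs C => h /negPf ne.
move: h; rewrite ne add0r; have [lt|nlt] := boolP (coset_lt D C); last first.
  rewrite big1 ?eqxx // => D' lt; case: eqP => [e|_]; last by rewrite mulr0.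
  by move: nlt; rewrite e lt.
move=> _; split=> //; have [p ep] := hP D lt; exists p.
rewrite (bigD1 D) // eqxx mulr1 big1; first by rewrite /= addr0 ep rmorphM.
by move=> D' /andP[_ /negPf ne']; rewrite eq_sym ne' mulr0.
Qed.

Lemma phi_len C D : phi C D != 0 -> D != C -> (len (shortest D) < len (shortest C))%N.
Proof using hPi hphi. by move=> h ne; have [/(coset_lt_len hPi)] := phi_supp h ne. Qed.

(** At a coset of maximal length among those with [d C != 0], only [phi C] contributes to the
    coefficient. *)
Lemma phi_free (d : wcoset Theta -> laurent) :
  \sum_C d C *: phi C = 0 -> forall C, d C = 0.
Proof using hPi hphi.
move=> e C0; apply/eqP; apply: contraT => d0.
have [C dC Cmax] := @arg_maxnP _ C0 (fun C => d C != 0) (fun C => len (shortest C)) d0.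
have /ffunP/(_ C) := e; rewrite sum_ffunE (bigD1 C) //= big1 => [|D ne].
  by rewrite !ffunE phi_diag addr0 laurent_scaleE mulr1 => /eqP; rewrite (negPf dC).
rewrite ffunE; have [->|dD] := eqVneq (d D) 0; first by rewrite scale0r.
have [->|h] := eqVneq (phi D C) 0; first by rewrite scaler0.
have := phi_len h; rewrite eq_sym => /(_ ne).
by rewrite ltnNge; have := Cmax D dD; rewrite /= => ->.
Qed.

Lemma self_dualD E E' : self_dual E -> self_dual E' -> self_dual (E + E').
Proof. by rewrite /self_dual linearD raddfD /= => -> ->. Qed.

Lemma self_dualN E : self_dual E -> self_dual (- E).
Proof. by rewrite /self_dual linearN raddfN /= => ->. Qed.

Lemma self_dual_intZ (z : int) E : self_dual E -> self_dual ((z%:~R : laurent) *: E).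
Proof. by rewrite /self_dual linearZ /= antispherical_barZ rmorph_int => ->. Qed.

Lemma self_dual_sum (P : pred (wcoset Theta)) (G : wcoset Theta -> coset_module Theta) :
  (forall C, P C -> self_dual (G C)) -> self_dual (\sum_(C | P C) G C).
Proof.
move=> h; apply: (big_ind (fun E => self_dual E)) => //; last exact: self_dualD.
by rewrite /self_dual linear0 raddf0.
Qed.

Lemma T_deltaE a C : coset_srefl C a <> C -> exists k : laurent,
  T_delta a C = k *: delta C + delta (coset_srefl C a) /\ (k = lq \/ k = lqV).
Proof.
move=> /eqP/negPf ne; rewrite /T_delta ne; case: ifP => _.
  by exists lq; split=> //; left.
by exists lqV; split=> //; right.
Qed.

Lemma delta2_coef k C D B :
  (k *: delta C + delta D) B = k * (B == C)%:R + (B == D)%:R :> laurent.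
Proof.
rewrite ffunE; congr (_ + _); last exact: delta_coef.
by rewrite scale_coef delta_coef.
Qed.

Lemma T_op_coef a E C : T_op a E C = \sum_D E D * T_delta a D C :> laurent.
Proof. by rewrite sum_ffunE; apply: eq_bigr => D _; rewrite scale_coef. Qed.

(** Only the delta functions of [C] and of [coset_srefl C a] can produce [delta C] under [T_op a].
    The first is too long to occur in [phi (coset_srefl C a)]; the second occurs with coefficient
    1. *)
Lemma T_phi_coef a C : coset_lt (coset_srefl C a) C ->
  T_op a (phi (coset_srefl C a)) C = 1.
Proof using hPi hphi.
move=> lt; set D := coset_srefl C a; rewrite T_op_coef.
have DC : D != C by case/andP: lt.
have CE : coset_srefl D a = C by rewrite coset_sreflK.
have [|k [e _]] := @T_deltaE a D; first by rewrite CE; apply/eqP; rewrite eq_sym.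
rewrite (bigD1 D) // phi_diag mul1r e delta2_coef CE eqxx.
rewrite eq_sym (negPf DC) mulr0 add0r big1 /= ?addr0 // => D' ne.
have [->|h] := eqVneq (phi D D') 0; first by rewrite mul0r.
have lt' := phi_len h ne; have [e'|/eqP ne'] := eqVneq (coset_srefl D' a) D'.
  by rewrite /T_delta e' eqxx ffunE mulr0.
have [k' [-> _]] := T_deltaE ne'; rewrite delta2_coef.
have [eC|_] := eqVneq C D'.
  by move: (ltn_trans lt' (coset_lt_len hPi lt)); rewrite eC ltnn.
have [eC|_] := eqVneq C (coset_srefl D' a).
  by move: ne; rewrite /D eC coset_sreflK eqxx.
by rewrite mulr0 addr0 mulr0.
Qed.

Lemma self_dual_of_T :
  (forall a C, coset_lt (coset_srefl C a) C -> exists n : wcoset Theta -> int,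
     T_op a (phi (coset_srefl C a)) = \sum_(D | coset_le D C) (n D)%:~R *: phi D) ->
  forall C, self_dual (phi C).
Proof using hPi hphi.
move=> hT C; have [n] := ubnP (len (shortest C)); elim: n C => // n IH C ltC.
have [e|/eqP ne] := eqVneq (shortest C) 1%g.
  (* Here [C] is [weyl_par Theta] itself: no coset is shorter, and its image 1 (x) 1 is fixed by the
     bar involution. *)
  have -> : phi C = delta C.
    have [P [_ ->]] := hphi C; rewrite big1 ?addr0 // => D /(coset_lt_len hPi).
    by rewrite e len1.
  rewrite /self_dual coset_iso_delta /tbasis e hecke_basis1 //.
  by rewrite antispherical_bar_tens !rmorph1.
have [a aC] := coset_descent hPi ne; have [k eT] := hT a C aC.
(* Compare coefficients at [C]: by length, no other [phi D] in the sum reaches [C]. *)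
have kC : (k C)%:~R = 1 :> laurent.
  rewrite -[RHS](T_phi_coef aC) eT sum_ffunE (bigD1 C) ?coset_le_refl //= big1.
    by rewrite ffunE phi_diag addr0 laurent_scaleE mulr1.
  move=> D /andP[le neD]; rewrite ffunE.
  have [->|h] := eqVneq (phi D C) 0; first by rewrite scaler0.
  have := phi_len h; rewrite eq_sym => /(_ neD) lt1.
  have lt2 : coset_lt D C by apply/andP.
  by move: (ltn_trans lt1 (coset_lt_len hPi lt2)); rewrite ltnn.
have -> : phi C = T_op a (phi (coset_srefl C a))
    - \sum_(D | coset_le D C && (D != C)) (k D)%:~R *: phi D.
  by rewrite eT (bigD1 C) ?coset_le_refl //= kC scale1r addrK.
apply: self_dualD.
  apply/T_self_dual/IH => //; exact: leq_trans (coset_lt_len hPi aC) ltC.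
apply/self_dualN/self_dual_sum => D /andP[le neD]; apply/self_dual_intZ/IH.
have lt : coset_lt D C by apply/andP.
exact: leq_trans (coset_lt_len hPi lt) ltC.
Qed.

Definition zspan C E : Prop := exists c : wcoset Theta -> {poly int},
  E = \sum_(D | coset_le D C) laurent_poly (c D) *: phi D.

Lemma zspanD C E E' : zspan C E -> zspan C E' -> zspan C (E + E').
Proof.
move=> [c ->] [c' ->]; exists (fun D => c D + c' D); rewrite -big_split.
by apply: eq_bigr => D _; rewrite rmorphD scalerDl.
Qed.

Lemma zspanZ C p E : zspan C E -> zspan C (laurent_poly p *: E).
Proof.
move=> [c ->]; exists (fun D => p * c D); rewrite scaler_sumr.
by apply: eq_bigr => D _; rewrite rmorphM scalerA.
Qed.

Lemma zspan0 C : zspan C 0.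
Proof. by exists (fun=> 0); rewrite big1 // => D _; rewrite rmorph0 scale0r. Qed.

Lemma zspan_sum C (P : pred (wcoset Theta)) (G : wcoset Theta -> coset_module Theta) :
  (forall D, P D -> zspan C (G D)) -> zspan C (\sum_(D | P D) G D).
Proof.
move=> h; apply: (big_ind (zspan C)) => //; first exact: zspan0.
exact: zspanD.
Qed.

Lemma zspan_phi C D : coset_le D C -> zspan C (phi D).
Proof.
move=> le; exists (fun D' => (D' == D)%:R); rewrite (bigD1 D) //= eqxx rmorph1.
rewrite scale1r big1 ?addr0 // => D' /andP[_ /negPf ->].
by rewrite rmorph0 scale0r.
Qed.

(** Inverts the unitriangular system by induction on length; no denominators arise. *)
Lemma zspan_delta C D : coset_le D C -> zspan C (delta D).
Proof using hPi hphi.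
have [n] := ubnP (len (shortest D)); elim: n D => // n IH D ltD le.
have [P [hP e]] := hphi D.
have -> : delta D = phi D +
    laurent_poly (-1) *: \sum_(D' | coset_lt D' D) P D' *: delta D'.
  by rewrite e rmorphN rmorph1 scaleN1r addrK.
apply: zspanD; first exact: zspan_phi.
apply/zspanZ/zspan_sum => D' lt; have [p ->] := hP _ lt.
rewrite -[lq * _](rmorphM laurent_poly); apply/zspanZ/IH.
  exact: leq_trans (coset_lt_len hPi lt) ltD.
exact: coset_le_trans (coset_ltW lt) le.
Qed.

(** The only threat to polynomial coefficients is the scalar q^-1 in [T_delta a D]. For [D]
    different from [B = coset_srefl C a], the coefficient of [delta D] in [phi B] is divisible by q
    and absorbs it. At [D = B] the coefficient is 1, but there the scalar is q, since [B] lies below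
    [C]. *)
Lemma zspan_T a C : coset_lt (coset_srefl C a) C ->
  zspan C (T_op a (phi (coset_srefl C a))).
Proof using hPi hphi.
move=> lt; set B := coset_srefl C a; apply: zspan_sum => D _.
have [->|h] := eqVneq (phi B D) 0; first by rewrite scale0r; apply: zspan0.
have leD : coset_le D B.
  have [->|ne] := eqVneq D B; first exact: coset_le_refl.
  by have [/coset_ltW] := phi_supp h ne.
have dD := zspan_delta (coset_le_trans leD (coset_ltW lt)).
have dDs := zspan_delta (coset_le_srefl hPi lt leD).
have [e|/eqP ne] := eqVneq (coset_srefl D a) D.
  by rewrite /T_delta e eqxx scaler0; apply: zspan0.
have [eD|neD] := eqVneq D B.
  have BC : coset_srefl B a = C by rewrite coset_sreflK.
  rewrite eD phi_diag scale1r /T_delta BC -/B.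
  rewrite eq_sym; case/andP: (lt) => /negPf -> _; rewrite lt.
  rewrite -eD; apply: zspanD; first exact: zspanZ.
  exact/zspan_delta/coset_le_refl.
have [k [-> hk]] := T_deltaE ne; have [_ [p ->]] := phi_supp h neD.
rewrite scalerDr scalerA; apply: zspanD; last exact: zspanZ.
have [r ->] : exists r, laurent_poly ('X * p) * k = laurent_poly r.
  case: hk => ->; first by exists ('X * p * 'X); rewrite [in RHS]rmorphM.
  by exists p; rewrite rmorphM mulrAC /= -/lq lqqV mul1r.
exact: zspanZ.
Qed.

Lemma T_of_self_dual : (forall C, self_dual (phi C)) ->
  forall a C, coset_lt (coset_srefl C a) C -> exists n : wcoset Theta -> int,
     T_op a (phi (coset_srefl C a)) = \sum_(D | coset_le D C) (n D)%:~R *: phi D.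
Proof using hPi hphi.
move=> sd a C lt; have [c e] := zspan_T lt.
(* The change of the coefficients under the bar involution, extended by 0 so that [phi_free] applies
   to a sum over all cosets. *)
pose d D := if coset_le D C then laurent_poly (c D) - lbar (laurent_poly (c D)) else 0.
have d0 : \sum_D d D *: phi D = 0.
  have -> : \sum_D d D *: phi D = T_op a (phi (coset_srefl C a))
      - \sum_(D | coset_le D C) lbar (laurent_poly (c D)) *: phi D.
    rewrite e -sumrB [RHS]big_mkcond; apply: eq_bigr => D _; rewrite /d.
    by case: ifP => _; rewrite ?scalerBl ?scale0r.
  apply: (coset_iso_eq0 hPi); rewrite linearB /= -(T_self_dual hPi a (sd _)) e.
  have iso_sum (k : wcoset Theta -> laurent) :
      coset_iso (\sum_(D | coset_le D C) k D *: phi D) =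
      \sum_(D | coset_le D C) k D *: coset_iso (phi D).
    by rewrite linear_sum; apply: eq_bigr => D _; rewrite linearZ.
  rewrite !iso_sum raddf_sum -sumrB big1 // => D _.
  by rewrite /= antispherical_barZ sd subrr.
(* The condition on [D] sits inside the existential so that an integer can be chosen for every
   coset. *)
have hn D : exists z : int, coset_le D C -> laurent_poly (c D) = z%:~R.
  have := phi_free d0 D; rewrite /d; case: ifP => _; last by exists 0.
  move=> /eqP; rewrite subr_eq0 => /eqP/esym/lbar_fixed_int[z ->].
  by exists z.
exists (fun D => sval (cid (hn D))); rewrite e; apply: eq_bigr => D le.
by case: cid => z /= ->.
Qed.

End KazhdanLusztig.

Theorem theorem6p3 (F : realFieldType) (V : vectType F) (Phi : rootSystem V)
    (Pi : {set rootT Phi}) (hPi : is_base Pi) (Theta : {set simple Pi})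
    (phi : wcoset Theta -> coset_module Theta)
    (hphi : forall C : wcoset Theta, exists P : wcoset Theta -> laurent,
       (forall D, coset_lt D C -> in_qZq (P D)) /\
       phi C = delta C + \sum_(D | coset_lt D C) P D *: delta D) :
  (forall (a : simple Pi) (C : wcoset Theta), coset_lt (coset_srefl C a) C ->
     exists n : wcoset Theta -> int,
       T_op a (phi (coset_srefl C a))
         = \sum_(D | coset_le D C) (n D)%:~R *: phi D)
  <->
  (forall C : wcoset Theta, self_dual (phi C)).
Proof. by split; [apply: self_dual_of_T | apply: T_of_self_dual]. Qed.
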